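(* Let $\mathcal{M}$ be a nonordinary $F$-circular Dieudonné module over $k$ of rank $r\ge2$. Then $n_{\mathcal{M}}\ge1$ and \[\gamma_{\mathcal{M}}(1)-\gamma_{\mathcal{M}}(0)>\gamma_{\mathcal{M}}(2)-\gamma_{\mathcal{M}}(1)>\cdots>\gamma_{\mathcal{M}}(n_{\mathcal{M}})-\gamma_{\mathcal{M}}(n_{\mathcal{M}}-1)>0.\]
   Context: $k$ is an algebraically closed field of characteristic $p$, $W(k)$ its Witt vectors, $\sigma$ the Frobenius. An $F$-crystal is a pair $(M,\varphi)$ with $M$ a free $W(k)$-module of finite rank and $\varphi$ a $\sigma$-linear injective endomorphism; it is a Dieudonné module if $pM\subset\varphi(M)\subset M$. A Dieudonné module is ordinary if $M=M_0\oplus M_1$ with $\varphi(M_0)=M_0$ and $\varphi(M_1)=pM_1$ (i.e. it is the Dieudonné module of $(\mathbb{Q}_p/\mathbb{Z}_p)^c\oplus\mu_{p^\infty}^d$). A Dieudonné module of rank $r$ is $F$-circular if there are an ordered $W(k)$-basis $(v_1,\dots,v_r)$ of $M$, integers $e_i\in\{0,1\}$ and an $r$-cycle $\pi$ of $\{1,\dots,r\}$ with $\varphi(v_i)=p^{e_i}v_{\pi(i)}$ for all $i$ (up to isomorphism). For $m\ge1$, $\gamma_{\mathcal{M}}(m)$ is the dimension of the smooth affine group scheme $\mathbf{Aut}_m(\mathcal{M})$ over $k$ whose $k$-points are the reductions modulo $p^m$ of $f\in\mathrm{GL}_M(W(k))$ with $\varphi f\varphi^{-1}\in f+p^m\mathrm{End}_M(W(k))$;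 $\gamma_{\mathcal{M}}(0)=0$. The isomorphism number $n_{\mathcal{M}}$ is the smallest nonnegative integer $n$ such that for every $W(k)$-linear automorphism $g$ of $M$ with $g\equiv1$ modulo $p^{n}$, the $F$-crystal $(M,g\varphi)$ is isomorphic to $\mathcal{M}$. *)

(* Defs.v *)
From HB Require Import structures.
From mathcomp Require Import all_boot all_order all_algebra all_fingroup.
From mathcomp Require Import boolp classical_sets mpoly zify.
From mathcomp Require finmap monalg.

Set Implicit Arguments.
Unset Strict Implicit.
Unset Printing Implicit Defensive.

Import GRing.Theory.
Local Open Scope ring_scope.

(* Integer polynomials in variables indexed by an arbitrary [choiceType] (Witt
   polynomials need infinitely many), with their evaluation in any commutative
   ring. *)
Section IntegerPolynomials.
Import finmap monalg.

Section Poly.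
Context (I : choiceType).

Local Notation zp := {malg int[{cmonom I}]}.
Definition zpoly : comNzRingType := zp.
Definition zvar (i : I) : zpoly := << ucm i >>.

Section Eval.
Context (R : comNzRingType) (x : I -> R).

Definition cmeval (m : {cmonom I}) : R := \prod_(i <- finsupp m) x i ^+ m i.

Lemma cmevalEw (d : {fset I}) (m : {cmonom I}) :
  fsubset (finsupp m) d -> cmeval m = \prod_(i <- d) x i ^+ m i.
Proof.
move=> le; rewrite /cmeval; apply: (big_fset_incl _ le) => i _.
by rewrite -cmE_neq0 negbK => /eqP ->; rewrite expr0.
Qed.

Lemma cmeval_mmorphism : mmorphism cmeval.
Proof.
split=> [m1 m2|]; last by rewrite /cmeval mdom1 big_seq_fset0.
have le1 : fsubset (finsupp m1) (finsupp (mmul m1 m2)).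
  by rewrite mdomD fsubsetUl.
have le2 : fsubset (finsupp m2) (finsupp (mmul m1 m2)).
  by rewrite mdomD fsubsetUr.
rewrite (cmevalEw le1) (cmevalEw le2) /cmeval -big_split /=.
by apply: eq_bigr => i _; rewrite cmM exprD.
Qed.

HB.instance Definition _ :=
  isMultiplicative.Build {cmonom I} R cmeval cmeval_mmorphism.

Definition zeval : {rmorphism zpoly -> R} := mmap (intr : int -> R) cmeval.

Lemma zeval_var i : zeval (zvar i) = x i.
Proof. by rewrite /zeval /= mmapU mul1r /cmeval mdomU big_seq_fset1 cmUU. Qed.

End Eval.

Lemma mcoeff_zmonom (c : int) (m k : {cmonom I}) :
  mcoeff k << c *g m >> = c *+ (m == k).
Proof. exact: mcoeffU. Qed.

Lemma zmonomE (c : int) (m : {cmonom I}) : << c *g m >> = << m >> *~ c :> zp.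
Proof.
apply/malgP => k; rewrite mcoeff_zmonom.
transitivity (mcoeff k (<< m >> : zp) *~ c).
  rewrite mcoeff_zmonom mulrzz.
  by case: (m == k); rewrite /= ?mulr1n ?mulr0n ?mul0r ?mul1r.
by rewrite (raddfMz (mcoeff k)).
Qed.

Lemma zpoly_morph_ext (S : pzRingType) (a b : {rmorphism zpoly -> S}) :
  (forall i, a (zvar i) = b (zvar i)) -> a =1 b.
Proof.
move=> eq_ab f; rewrite (monalgE (f : {malg int[{cmonom I}]})) !rmorph_sum /=.
apply: eq_bigr => m _; rewrite zmonomE !rmorphMz; congr (_ *~ _).
have [n] := ubnP (mdeg m); elim: n m => // n IHn m; rewrite ltnS => le_mn.
have [->|m_neq1] := eqVneq m mone; first by rewrite !(rmorph1 _).
have [i i_m] : exists i, i \in finsupp m.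
  apply/fset0Pn; apply: contraNneq m_neq1 => m0.
  by rewrite -mdeg_eq0 mdegE m0 big_seq_fset0.
pose m' := divcm m (ucm i).
have def_m : m = mmul (ucm i) m'.
  apply/eqP/cmP => j; rewrite cmM divcmE cmU subnKC //.
  by case: eqP => // <-; rewrite lt0n cmE_neq0.
have -> : << m >> = zvar i * << m' >> :> zpoly.
  by rewrite /zvar [RHS]fgmulUU mulr1 -def_m.
rewrite (rmorphM a) (rmorphM b); congr (_ * _); first exact: eq_ab.
apply: IHn; apply: leq_trans le_mn.
by rewrite def_m mdegM mdegU.
Qed.

(* Coefficientwise division of an integer polynomial by [n]; it is only used on
   multiples of [n], see [zdivnK]. *)
Definition zdivn (n : nat) (f : zpoly) : zpoly :=
  \sum_(m <- msupp f) << (mcoeff m f %/ n%:Z)%Z *g m >>.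

Lemma mcoeff_zdivn n (f : zp) m :
  mcoeff m (zdivn n f : zp) = (mcoeff m f %/ n%:Z)%Z.
Proof.
transitivity (\sum_(k <- msupp f) (mcoeff k f %/ n%:Z)%Z *+ (k == m)).
  rewrite /zdivn (raddf_sum (mcoeff m)); apply: eq_bigr => k _.
  exact: mcoeff_zmonom.
have [fm|fm] := boolP (m \in msupp f).
  rewrite (big_fsetD1 m) //= eqxx big1_fset ?addr0 // => k.
  by rewrite in_fsetD1; case: eqP.
rewrite (mcoeff_outdom fm) div0z big1_fset // => k fk _.
by case: eqP fk fm => // -> ->.
Qed.

Lemma zdivnK n (f : zpoly) : (0 < n)%N -> zdivn n (f *+ n) = f.
Proof.
move=> n_gt0; apply/malgP => m; rewrite mcoeff_zdivn mcoeffMn.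
by rewrite -mulr_natr pmulrn intz mulzK // -lt0n.
Qed.

Lemma zpoly_mulrnI n : (0 < n)%N -> injective (fun f : zpoly => f *+ n).
Proof. by move=> n_gt0; apply: (can_inj (fun f => zdivnK f n_gt0)). Qed.

Section Reduction.
Context (p : nat) (p_prime : prime p).
Local Notation rp := {malg 'F_p[{cmonom I}]}.

Definition rmonom (m : {cmonom I}) : rp := << m >>.

Lemma rmonom_mmorphism : mmorphism rmonom.
Proof.
by split=> // m1 m2; rewrite /rmonom [RHS]fgmulUU mulr1.
Qed.

HB.instance Definition _ :=
  isMultiplicative.Build {cmonom I} rp rmonom rmonom_mmorphism.

Definition zred : {rmorphism zpoly -> rp} := mmap (intr : int -> rp) rmonom.

Lemma mcoeff_zred (f : zp) m : mcoeff m (zred f) = (mcoeff m f)%:~R.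
Proof.
rewrite /zred /= mmapE (raddf_sum (mcoeff m)) /=.
rewrite (eq_bigr (fun k => (mcoeff k f)%:~R *+ (k == m))) => [|k _]; last first.
  rewrite mulrzl (raddfMz (mcoeff m)) /=.
  rewrite (_ : mcoeff m (rmonom k) = (k == m)%:R); last exact: mcoeffU.
  by case: (k == m); rewrite ?mulr1n ?mulr0n ?mul0rz.
have [fm|fm] := boolP (m \in msupp f).
  rewrite (big_fsetD1 m) //= eqxx big1_fset ?addr0 // => k.
  by rewrite in_fsetD1; case: eqP.
rewrite (mcoeff_outdom fm) big1_fset // => k fk _.
by case: eqP fk fm => // -> ->.
Qed.

Lemma rpoly_pchar : p \in [pchar rp].
Proof.
rewrite inE p_prime /= -(mpolyC_nat _ _ p) pchar_Fp_0 //.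
by rewrite malgC0E.
Qed.

Lemma zpoly_frobenius (f : zpoly) :
  exists g, f ^+ p = zeval (fun i => zvar i ^+ p) f + g *+ p.
Proof.
set phi := zeval _.
have eq_red : pFrobenius_aut rpoly_pchar \o zred =1 zred \o phi.
  apply: zpoly_morph_ext => i /=; rewrite pFrobenius_autE.
  by rewrite /phi zeval_var rmorphXn.
exists (zdivn p (f ^+ p - phi f)); apply/eqP; rewrite addrC -subr_eq; apply/eqP.
apply/malgP => m; rewrite mcoeffMn mcoeff_zdivn.
rewrite -mulr_natr pmulrn intz divzK //.
have := mcoeff_zred (f ^+ p - phi f) m; rewrite rmorphB rmorphXn /=.
have := eq_red f; rewrite /= pFrobenius_autE => ->; rewrite subrr mcoeff0.
move/esym/eqP; by rewrite -(dvdz_pcharf (pchar_Fp p_prime)).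
Qed.

End Reduction.
End Poly.
End IntegerPolynomials.

Arguments zvar {I} i.
Arguments zdivn {I} n f.

Section Ghost.
Context (p : nat).

Definition ghost (R : pzSemiRingType) (x : nat -> R) (n : nat) : R :=
  \sum_(i < n.+1) x i ^+ (p ^ (n - i)) *+ p ^ i.

Lemma ghost_morph (R S : pzSemiRingType) (h : {rmorphism R -> S}) x n :
  ghost (h \o x) n = h (ghost x n).
Proof.
by rewrite rmorph_sum; apply: eq_bigr => i _; rewrite rmorphMn rmorphXn.
Qed.

Section Solve.
Context (R : comNzRingType) (divn_ : nat -> R -> R) (w : nat -> R).

Fixpoint ghost_solve_seq (n : nat) : seq R :=
  if n is n'.+1 then
    let s := ghost_solve_seq n' in
    rcons s (divn_ (p ^ n')
      (w n' - \sum_(i < n') s`_i ^+ (p ^ (n' - i)) *+ p ^ i))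
  else [::].

(* The sequence with ghost components [w], obtained by solving
   [w n = \sum_(i <= n) x i ^+ (p ^ (n - i)) *+ p ^ i] for [x n]. *)
Definition ghost_solve (n : nat) : R := (ghost_solve_seq n.+1)`_n.

Lemma size_ghost_solve_seq n : size (ghost_solve_seq n) = n.
Proof. by elim: n => //= n IHn; rewrite size_rcons IHn. Qed.

Lemma nth_ghost_solve_seq n i :
  (i < n)%N -> (ghost_solve_seq n)`_i = ghost_solve i.
Proof.
elim: n => // n IHn; rewrite ltnS leq_eqVlt => /orP[/eqP -> // | lt_in].
by rewrite -(IHn lt_in) [LHS]nth_rcons size_ghost_solve_seq lt_in.
Qed.

Lemma ghost_solveE n :
  ghost_solve n = divn_ (p ^ n)
    (w n - \sum_(i < n) ghost_solve i ^+ (p ^ (n - i)) *+ p ^ i).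
Proof.
rewrite [LHS]nth_rcons size_ghost_solve_seq ltnn eqxx.
congr (divn_ _ (_ - _)); apply: eq_bigr => i _.
by rewrite nth_ghost_solve_seq.
Qed.

End Solve.

Hypothesis p_prime : prime p.

Lemma expr_congr_step (R : comPzRingType) (b c : R) s :
  exists d, (b + c *+ p ^ s.+1) ^+ p = b ^+ p + d *+ p ^ s.+2.
Proof.
have p2 : (1 < p)%N by apply: prime_gt1.
rewrite exprDn big_ord_recl /= subn0 expr0 mulr1 bin0.
case: p p2 => // q; rewrite ltnS => q_gt0.
pose F (i : 'I_q.+1) := b ^+ (q - i) * c ^+ i.+1 *+
   ('C(q.+1, i.+1) * q.+1 ^ (s.+1 * i.+1) %/ q.+1 ^ s.+2).
exists (\sum_i F i); congr (_ + _); rewrite -sumrMnl; apply: eq_bigr => i _.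
rewrite /F /bump /= add1n subSS exprMn_n mulrnAr -!mulrnA.
rewrite divnK -?expnM 1?mulnC //.
case: i => -[|i] lti /=.

  by rewrite bin1 muln1 -expnSr dvdnn.

apply: dvdn_mulr; apply: dvdn_exp2l.
by rewrite mulnS mulnS; lia.
Qed.

Lemma expr_congr (R : comPzRingType) (a b c : R) j :
  a = b + c *+ p -> exists d, a ^+ (p ^ j) = b ^+ (p ^ j) + d *+ p ^ j.+1.
Proof.
move=> ->; elim: j => [|j [d IHj]]; first by exists c; rewrite !expr1.
have [d' Hd'] := expr_congr_step (b ^+ (p ^ j)) d j.
by exists d'; rewrite (expnSr p j) !exprM IHj Hd'.
Qed.

Section Dwork.
Context (R : comNzRingType) (divn_ : nat -> R -> R) (phi : {rmorphism R -> R}).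
Hypothesis divnK_ : forall n f, (0 < n)%N -> divn_ n (f *+ n) = f.
Hypothesis phiP : forall f, exists g, f ^+ p = phi f + g *+ p.

(* The congruences which characterise the sequences of ghost components. *)
Definition ghost_integral (w : nat -> R) :=
  forall n, exists g, w n.+1 = phi (w n) + g *+ p ^ n.+1.

Lemma ghost_integralX (x : nat -> R) : (forall i, phi (x i) = x i ^+ p) ->
  ghost_integral (ghost x).
Proof.
move=> phix n; exists (x n.+1).
rewrite /ghost big_ord_recr /= subnn expr1; congr (_ + _).
rewrite rmorph_sum; apply: eq_bigr => i _ /=.
by rewrite rmorphMn rmorphXn phix -exprM -expnS subSn // -ltnS.
Qed.

Lemma ghost_integralD w1 w2 : ghost_integral w1 -> ghost_integral w2 ->
  ghost_integral (fun n => w1 n + w2 n).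
Proof.
move=> h1 h2 n; have [g1 ->] := h1 n; have [g2 ->] := h2 n.
by exists (g1 + g2); rewrite rmorphD mulrnDl addrACA.
Qed.

Lemma ghost_integralN w : ghost_integral w -> ghost_integral (fun n => - w n).
Proof.
move=> h n; have [g ->] := h n.
by exists (- g); rewrite rmorphN mulNrn opprD.
Qed.

Lemma ghost_integralM w1 w2 : ghost_integral w1 -> ghost_integral w2 ->
  ghost_integral (fun n => w1 n * w2 n).
Proof.
move=> h1 h2 n; have [g1 ->] := h1 n; have [g2 ->] := h2 n.
exists (phi (w1 n) * g2 + g1 * phi (w2 n) + g1 * g2 *+ p ^ n.+1).
rewrite rmorphM mulrDl !mulrDr !mulrnDl -!addrA.
by rewrite !mulrnAr !mulrnAl.
Qed.

Lemma ghost_solveK w : ghost_integral w -> ghost (ghost_solve divn_ w) =1 w.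
Proof.
move=> wP n; elim/ltn_ind: n => n IHn.
rewrite /ghost big_ord_recr /= subnn expr1 ghost_solveE.
suff [g ->] : exists g, w n =
    \sum_(i < n) ghost_solve divn_ w i ^+ (p ^ (n - i)) *+ p ^ i + g *+ p ^ n.
  by rewrite [X in divn_ _ X]addrC addKr divnK_ // expn_gt0 prime_gt0.
case: n IHn => [|n] IHn; first by exists (w 0%N); rewrite big_ord0 add0r.
have [g ->] := wP n; rewrite -(IHn n) // /ghost rmorph_sum.
set s := ghost_solve divn_ w.
have step (i : 'I_n.+1) : exists d,
    s i ^+ (p ^ (n.+1 - i)) *+ p ^ i =
    phi (s i ^+ (p ^ (n - i)) *+ p ^ i) + d *+ p ^ n.+1.
  have [c Hc] := phiP (s i).
  have [d Hd] := expr_congr (n - i) Hc; exists d.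
  have le_in : (i <= n)%N by rewrite -ltnS.
  rewrite subSn // expnS exprM Hd mulrnDl -mulrnA rmorphMn rmorphXn.
  by rewrite -expnD addSn subnK.
have /choice [d Hd] := step; exists (g - \sum_i d i).
rewrite (eq_bigr _ (fun i _ => Hd i)) big_split /= mulrnBl -sumrMnl.
by rewrite -addrA; congr (_ + _); rewrite addrC subrK.
Qed.

Lemma ghost_inj (x y : nat -> R) : ghost x =1 ghost y -> x = y.
Proof.
move=> eq_xy; apply/funext => n; elim/ltn_ind: n => n IHn.
have := eq_xy n; rewrite /ghost !big_ord_recr /= subnn !expr1.
rewrite (eq_bigr (fun i : 'I_n => y i ^+ (p ^ (n - i)) *+ p ^ i)) => [|i _].
  move/addrI/(congr1 (divn_ (p ^ n))).
  by rewrite !divnK_ // expn_gt0 prime_gt0.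
by rewrite IHn.
Qed.

End Dwork.
End Ghost.

Section WittPolynomials.
Context (p : nat).

(* The Witt polynomials: the integer polynomials with the prescribed ghost
   components (sum, product and opposite of the generic ones). *)
Definition wadd_poly : nat -> zpoly (nat + nat)%type :=
  ghost_solve p zdivn (fun n =>
    ghost p (zvar \o inl) n + ghost p (zvar \o inr) n).

Definition wmul_poly : nat -> zpoly (nat + nat)%type :=
  ghost_solve p zdivn (fun n =>
    ghost p (zvar \o inl) n * ghost p (zvar \o inr) n).

Definition wopp_poly : nat -> zpoly nat :=
  ghost_solve p zdivn (fun n => - ghost p (zvar : nat -> zpoly nat) n).

Definition sum_fun (I J : Type) (R : Type) (x : I -> R) (y : J -> R)
  (v : I + J) : R := match v with inl i => x i | inr j => y j end.

End WittPolynomials.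

Definition wzero (R : comNzRingType) : nat -> R := fun _ => 0.

Definition wone (R : comNzRingType) : nat -> R := fun n => (n == 0%N)%:R.

(* These are locked to keep unification from unfolding the Witt polynomials. *)
HB.lock Definition wadd (p : nat) (R : comNzRingType) (x y : nat -> R) :
  nat -> R := fun n => zeval (sum_fun x y) (wadd_poly p n).

HB.lock Definition wmul (p : nat) (R : comNzRingType) (x y : nat -> R) :
  nat -> R := fun n => zeval (sum_fun x y) (wmul_poly p n).

HB.lock Definition wopp (p : nat) (R : comNzRingType) (x : nat -> R) :
  nat -> R := fun n => zeval x (wopp_poly p n).

Section WittOperations.
Context (p : nat).

Section Naturality.
Context (R S : comNzRingType) (h : {rmorphism R -> S}).
Implicit Types x y : nat -> R.

Lemma zeval_morph (I : choiceType) (x : I -> R) f :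
  h (zeval x f) = zeval (h \o x) f.
Proof.
apply: (zpoly_morph_ext (a := h \o zeval x)) => i.
by rewrite [RHS]zeval_var; exact: (congr1 h (zeval_var x i)).
Qed.

Lemma wadd_morph x y : h \o wadd p x y = wadd p (h \o x) (h \o y).
Proof.
rewrite unlock; apply/funext => n.
transitivity (zeval (h \o sum_fun x y) (wadd_poly p n)).
  exact: zeval_morph.
by congr (zeval _ _); apply/funext => -[].
Qed.

Lemma wmul_morph x y : h \o wmul p x y = wmul p (h \o x) (h \o y).
Proof.
rewrite unlock; apply/funext => n.
transitivity (zeval (h \o sum_fun x y) (wmul_poly p n)).
  exact: zeval_morph.
by congr (zeval _ _); apply/funext => -[].
Qed.

Lemma wopp_morph x : h \o wopp p x = wopp p (h \o x).
Proof. by rewrite unlock; apply/funext => n; exact: zeval_morph. Qed.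

Lemma wzero_morph : h \o @wzero R = @wzero S.
Proof. by apply/funext => n; rewrite /wzero /= rmorph0. Qed.

Lemma wone_morph : h \o @wone R = @wone S.
Proof. by apply/funext => n; rewrite /wone /= rmorph_nat. Qed.

End Naturality.

Hypothesis p_prime : prime p.

Let phi I : {rmorphism zpoly I -> zpoly I} := zeval (fun i => zvar i ^+ p).

Let zsolveK (I : choiceType) (w : nat -> zpoly I) :
  ghost_integral p (phi I) w -> ghost p (ghost_solve p zdivn w) =1 w.
Proof.
apply: ghost_solveK => // [n f|f]; first exact: zdivnK.
exact: zpoly_frobenius.
Qed.

Let zvar_integral (I : choiceType) (f : nat -> I) :
  ghost_integral p (phi I) (ghost p (zvar \o f)).
Proof. by apply: ghost_integralX => i; exact: zeval_var. Qed.

Section GhostOperations.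
Context (R : comNzRingType).
Implicit Types x y : nat -> R.

Let ghost_var (I : choiceType) (x : I -> R) (f : nat -> I) n :
  zeval x (ghost p (zvar \o f) n) = ghost p (x \o f) n.
Proof.
rewrite -(ghost_morph p (zeval x)); congr (ghost _ _ _).
by apply/funext => i; exact: zeval_var.
Qed.

Lemma ghost_wadd x y n : ghost p (wadd p x y) n = ghost p x n + ghost p y n.
Proof.
rewrite wadd.unlock (ghost_morph p (zeval (sum_fun x y)) (wadd_poly p)) zsolveK.
  apply: etrans (rmorphD (zeval (sum_fun x y)) _ _) _.
  by apply: congr2; [exact: (ghost_var _ inl) | exact: (ghost_var _ inr)].
by apply: ghost_integralD; apply: zvar_integral.
Qed.

Lemma ghost_wmul x y n : ghost p (wmul p x y) n = ghost p x n * ghost p y n.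
Proof.
rewrite wmul.unlock (ghost_morph p (zeval (sum_fun x y)) (wmul_poly p)) zsolveK.
  apply: etrans (rmorphM (zeval (sum_fun x y)) _ _) _.
  by apply: congr2; [exact: (ghost_var _ inl) | exact: (ghost_var _ inr)].
by apply: ghost_integralM; apply: zvar_integral.
Qed.

Lemma ghost_wopp x n : ghost p (wopp p x) n = - ghost p x n.
Proof.
rewrite wopp.unlock (ghost_morph p (zeval x) (wopp_poly p)) zsolveK.
  apply: etrans (rmorphN (zeval x) _) _.
  by apply: congr1; exact: (ghost_var _ id).
by apply: ghost_integralN; apply: (zvar_integral id).
Qed.

Lemma ghost_wzero n : ghost p (@wzero R) n = 0.
Proof.
rewrite /ghost big1 // => i _; rewrite /wzero expr0n expn_eq0.
by rewrite -leqn0 leqNgt prime_gt0 //= mul0rn.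
Qed.

Lemma ghost_wone n : ghost p (@wone R) n = 1.
Proof.
rewrite /ghost big_ord_recl /wone /= expr1n big1 ?addr0 // => i _.
by rewrite expr0n expn_eq0 -leqn0 leqNgt prime_gt0 //= mul0rn.
Qed.

End GhostOperations.

Section RingLaws.
Context (R : comNzRingType).
Implicit Types x y z : nat -> R.

(* Any Witt vectors lift to a ring on which the ghost map is injective. *)
Lemma witt_lift x y z :
  exists (A : comNzRingType) (h : {rmorphism A -> R}) (x' y' z' : nat -> A),
  [/\ injective (ghost p (R := A)), h \o x' = x, h \o y' = y & h \o z' = z].
Proof.
exists (zpoly (nat + nat + nat)%type), (zeval (sum_fun (sum_fun x y) z)).
exists (zvar \o inl \o inl), (zvar \o inl \o inr), (zvar \o inr).
split; [|by apply/funext => n; exact: zeval_var..].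
move=> a b eq_ab; apply: (ghost_inj p_prime (divn_ := zdivn)).
  by move=> n f; exact: zdivnK.
by rewrite eq_ab.
Qed.

Definition ghostE :=
  (ghost_wadd, ghost_wmul, ghost_wopp, ghost_wzero, ghost_wone).
Definition wmorphE :=
  (wadd_morph, wmul_morph, wopp_morph, wzero_morph, wone_morph).

Lemma waddA : associative (@wadd p R).
Proof.
move=> x y z; have [A [h [x' [y' [z' [inj <- <- <-]]]]]] := witt_lift x y z.
rewrite -!wmorphE; congr (_ \o _); apply/inj/funext => n.
by rewrite !ghostE addrA.
Qed.

Lemma waddC : commutative (@wadd p R).
Proof.
move=> x y; have [A [h [x' [y' [z' [inj <- <- _]]]]]] := witt_lift x y x.
rewrite -!wmorphE; congr (_ \o _); apply/inj/funext => n.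
by rewrite !ghostE addrC.
Qed.

Lemma wadd0 : left_id (@wzero R) (@wadd p R).
Proof.
move=> x; have [A [h [x' [y' [z' [inj <- _ _]]]]]] := witt_lift x x x.
rewrite -(wzero_morph h) -!wadd_morph; congr (_ \o _); apply/inj/funext => n.
by rewrite !ghostE add0r.
Qed.

Lemma waddN : left_inverse (@wzero R) (@wopp p R) (@wadd p R).
Proof.
move=> x; have [A [h [x' [y' [z' [inj <- _ _]]]]]] := witt_lift x x x.
rewrite -(wzero_morph h) -wopp_morph -!wadd_morph; congr (_ \o _).
by apply/inj/funext => n; rewrite !ghostE addNr.
Qed.

Lemma wmulA : associative (@wmul p R).
Proof.
move=> x y z; have [A [h [x' [y' [z' [inj <- <- <-]]]]]] := witt_lift x y z.
rewrite -!wmorphE; congr (_ \o _); apply/inj/funext => n.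
by rewrite !ghostE mulrA.
Qed.

Lemma wmulC : commutative (@wmul p R).
Proof.
move=> x y; have [A [h [x' [y' [z' [inj <- <- _]]]]]] := witt_lift x y x.
rewrite -!wmorphE; congr (_ \o _); apply/inj/funext => n.
by rewrite !ghostE mulrC.
Qed.

Lemma wmul1 : left_id (@wone R) (@wmul p R).
Proof.
move=> x; have [A [h [x' [y' [z' [inj <- _ _]]]]]] := witt_lift x x x.
rewrite -(wone_morph h) -!wmul_morph; congr (_ \o _); apply/inj/funext => n.
by rewrite !ghostE mul1r.
Qed.

Lemma wmulDl : left_distributive (@wmul p R) (@wadd p R).
Proof.
move=> x y z; have [A [h [x' [y' [z' [inj <- <- <-]]]]]] := witt_lift x y z.
rewrite -!(wmul_morph h) -!(wadd_morph h) -(wmul_morph h); congr (_ \o _).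
by apply/inj/funext => n; rewrite !ghostE mulrDl.
Qed.

Lemma wone_neq0 : @wone R <> @wzero R.
Proof.
by move/(congr1 (fun x => x 0%N))/eqP; rewrite /wone /wzero oner_eq0.
Qed.

End RingLaws.
End WittOperations.

(* The proof [pcharR] provides the primality of [p] to the ring structure. *)
Record witt (R : comNzRingType) (p : nat) (pcharR : p \in [pchar R]) :=
  Witt { wcoef :> nat -> R }.

Section WittVectors.
Context (R : comNzRingType) (p : nat) (pcharR : p \in [pchar R]).
Local Notation witt := (witt pcharR).
Local Notation Witt := (Witt pcharR).

Lemma wcoefK (x : witt) : Witt (wcoef x) = x. Proof. by case: x. Qed.

Lemma witt_ext (x y : witt) : wcoef x = wcoef y -> x = y.
Proof. by case: x y => x [y] /= ->. Qed.

HB.instance Definition _ := gen_eqMixin witt.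
HB.instance Definition _ := gen_choiceMixin witt.

Let p_prime : prime p := pcharf_prime pcharR.

Let addA : associative (fun x y : witt => Witt (wadd p x y)).
Proof. by move=> x y z; apply/witt_ext; exact: waddA. Qed.
Let addC : commutative (fun x y : witt => Witt (wadd p x y)).
Proof. by move=> x y; apply/witt_ext; exact: waddC. Qed.
Let add0 : left_id (Witt (@wzero R)) (fun x y : witt => Witt (wadd p x y)).
Proof. by move=> x; apply/witt_ext; exact: wadd0. Qed.
Let addN : left_inverse (Witt (@wzero R)) (fun x : witt => Witt (wopp p x))
  (fun x y : witt => Witt (wadd p x y)).
Proof. by move=> x; apply/witt_ext; exact: waddN. Qed.
HB.instance Definition _ := GRing.isZmodule.Build witt addA addC add0 addN.

Let mulA : associative (fun x y : witt => Witt (wmul p x y)).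
Proof. by move=> x y z; apply/witt_ext; exact: wmulA. Qed.
Let mulC : commutative (fun x y : witt => Witt (wmul p x y)).
Proof. by move=> x y; apply/witt_ext; exact: wmulC. Qed.
Let mul1 : left_id (Witt (@wone R)) (fun x y : witt => Witt (wmul p x y)).
Proof. by move=> x; apply/witt_ext; exact: wmul1. Qed.
Let mulDl : left_distributive (fun x y : witt => Witt (wmul p x y)) +%R.
Proof. by move=> x y z; apply/witt_ext; exact: wmulDl. Qed.
Let one_neq0 : Witt (@wone R) != 0.
Proof. by apply/eqP => /(congr1 (@wcoef _ _ _)); exact: wone_neq0. Qed.
HB.instance Definition _ :=
  GRing.Zmodule_isComNzRing.Build witt mulA mulC mul1 mulDl one_neq0.

Definition wfrob (x : witt) : witt := Witt (fun n => x n ^+ p).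

Let wfrob_is_zmod_morphism : zmod_morphism wfrob.
Proof.
move=> x y; apply/witt_ext.
apply: etrans (wadd_morph p (pFrobenius_aut pcharR) x (wopp p y)) _.
by rewrite wopp_morph.
Qed.
Let wfrob_is_monoid_morphism : monoid_morphism wfrob.
Proof.
split=> [|x y]; apply/witt_ext.
  exact: (wone_morph (pFrobenius_aut pcharR)).
exact: (wmul_morph p (pFrobenius_aut pcharR) x y).
Qed.
HB.instance Definition _ :=
  GRing.isZmodMorphism.Build witt witt wfrob wfrob_is_zmod_morphism.
HB.instance Definition _ :=
  GRing.isMonoidMorphism.Build witt witt wfrob wfrob_is_monoid_morphism.

End WittVectors.

Section Zariski.
Context (k : fieldType) (n : nat).
Local Open Scope classical_set_scope.
Implicit Types X Z A B : set ('I_n -> k).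

Definition zariski_closed X Z :=
  exists E : set {mpoly k[n]}, Z = X `&` [set x | forall f, E f -> f.@[x] = 0].

Definition zariski_irreducible X Z :=
  [/\ zariski_closed X Z, Z !=set0 &
      forall A B, zariski_closed X A -> zariski_closed X B ->
        Z `<=` A `|` B -> Z `<=` A \/ Z `<=` B].

Definition has_chain X (d : nat) := exists Z : nat -> set ('I_n -> k),
  (forall i, (i <= d)%N -> zariski_irreducible X (Z i)) /\
  (forall i, (i < d)%N -> Z i `<` Z i.+1).

(* Krull dimension of [X] for the topology induced by the Zariski topology of
   affine [n]-space; over an algebraically closed field it is the dimension of
   the reduced scheme whose set of rational points is [X], if [X] is locally
   closed. The default value 0 is not used for nonempty [X]. *)
Definition zariski_dim X : nat :=
  xget 0%N [set d | has_chain X d /\ ~ has_chain X d.+1].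

End Zariski.

Section FCrystals.
Context (k : closedFieldType) (p : nat) (pchark : p \in [pchar k]).
Local Notation W := (witt pchark).
Local Open Scope classical_set_scope.

Record fcrystal := FCrystal {
  fc_mod :> vectType W;
  fc_phi : {linear fc_mod -> fc_mod | @wfrob k p pchark \; *:%R};
  fc_phi_inj : injective fc_phi }.

Definition fc_iso (M N : fcrystal) := exists h : {linear M -> N},
  bijective h /\ forall x, h (fc_phi M x) = fc_phi N (h x).

Section Twist.
Context (M : fcrystal) (g : {linear M -> M}) (g_inj : injective g).

Definition twist_phi (x : M) : M := g (fc_phi M x).

Fact twist_phi_semilinear : linear_for (@wfrob k p pchark \; *:%R) twist_phi.
Proof. by move=> a x y; rewrite /twist_phi !linearP. Qed.

HB.instance Definition _ :=
  GRing.isLinear.Build W M M _ twist_phi twist_phi_semilinear.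

Fact twist_phi_inj : injective twist_phi.
Proof. exact: inj_comp g_inj (@fc_phi_inj M). Qed.

Definition twist : fcrystal := @FCrystal M twist_phi twist_phi_inj.

End Twist.

Section Invariants.
Context (M : fcrystal).
Local Notation phi := (fc_phi M).
Local Notation rank := (dim M).

Definition pmul (A : set M) : set M := [set p%:R *: x | x in A].

Definition is_dieudonne := pmul setT `<=` phi @` setT.

Definition is_submodule (A : set M) :=
  A 0 /\ forall (a : W) x y, A x -> A y -> A (a *: x + y).

Definition is_direct_sum (A B : set M) :=
  forall x, exists! u : M * M, [/\ A u.1, B u.2 & x = u.1 + u.2].

Definition is_ordinary := exists M0 M1 : set M,
  [/\ is_submodule M0, is_submodule M1, is_direct_sum M0 M1,
      phi @` M0 = M0 & phi @` M1 = pmul M1].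

Definition is_basis (r : nat) (v : 'I_r -> M) :=
  forall x, exists! c : {ffun 'I_r -> W}, x = \sum_i c i *: v i.

Definition is_circular :=
  exists (v : 'I_rank -> M) (e : 'I_rank -> nat) (pi : 'S_rank),
  [/\ is_basis v, forall i, (e i <= 1)%N, forall i j, j \in porbit pi i &
      forall i, phi (v i) = p%:R ^+ e i *: v (pi i)].

Definition congr1_mod (n : nat) (g : {linear M -> M}) :=
  exists h : {linear M -> M}, forall x, g x = x + p%:R ^+ n *: h x.

Definition iso_bound (n : nat) :=
  forall (g : {linear M -> M}) (g_bij : bijective g),
  congr1_mod n g -> fc_iso (twist (bij_inj g_bij)) M.

Definition isomorphism_number : nat :=
  xget 0%N [set n | iso_bound n /\ forall m, iso_bound m -> (n <= m)%N].

(* [phi f phi^-1 = f + p^m h] for an endomorphism [h] of [M], as an identity in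
   [End M[1/p]] composed on the right with the bijection [phi] of [M[1/p]]. *)
Definition phi_stable_mod (m : nat) (f : {linear M -> M}) :=
  exists h : {linear M -> M},
  forall x, phi (f x) = f (phi x) + p%:R ^+ m *: h (phi x).

Definition end_mx (f : {linear M -> M}) : 'M[W]_rank :=
  \matrix_(i, j) VectorInternalTheory.v2r
    (f (VectorInternalTheory.r2v (delta_mx 0 i))) 0 j.

(* The matrix of [f] modulo [p ^ m], as a point of affine space: an element of
   [W / p ^ m] is given by its first [m] Witt coordinates. *)
Definition end_point (m : nat) (f : {linear M -> M}) :
    'I_#|{: 'I_rank * 'I_rank * 'I_m}| -> k :=
  fun t => let: (i, j, l) := enum_val t in wcoef (end_mx f i j) l.
Arguments end_point : clear implicits.

Definition aut_points (m : nat) :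
    set ('I_#|{: 'I_rank * 'I_rank * 'I_m}| -> k) :=
  [set end_point m f |
    f in [set f : {linear M -> M} | bijective f /\ phi_stable_mod m f]].
Arguments aut_points : clear implicits.

Definition gamma (m : nat) : nat :=
  if m is 0%N then 0%N else zariski_dim (aut_points m).

End Invariants.
End FCrystals.

(* Main.v *)
Require Import Defs.
From HB Require Import structures.
From mathcomp Require Import all_boot all_order all_algebra all_fingroup.
From mathcomp Require Import boolp classical_sets mpoly zify ring.

(* Write [phi v_i = p^(e_i) v_(pi i)]. On matrix entries [x_ij], conjugation by
   [phi] is [x_ij |-> p^(e_j - e_i) sigma(x_ij)] at the place [(pi i, pi j)], and
   [p] is [V F], so modulo [p^m] the stabiliser equations say that a Witt
   coordinate is 0 or a [p]-power of another one: the coordinate of level [l] at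
   [(i, j)] is linked to the one of level [l + e_j - e_i] at [(pi i, pi j)].
   Cutting the orbits of pairs at the levels [0 <= l < m], a path of coordinates
   is free exactly when it both enters and leaves through level [m], cycles
   contribute finitely many values, and all other coordinates vanish. Thus
   [gamma m - gamma m.-1] is the number of excursions of depth exactly [m] below
   a starting height of the periodic functions [u |-> sum_(w < u) (e_(pi^w j) -
   e_(pi^w i))].

   An excursion of depth [m.+1] contains one of depth [m] one step below its
   start, and is determined by it. Not every excursion of depth [m] arises in
   this way: the amplitude of the height function changes by at most 1 when [j]
   is replaced by [pi j] and is 0 for [j = i], so every [m] up to the maximal
   amplitude [h] is the amplitude of some orbit, and the deepest excursion there
   lies in no deeper one.

   Finally [1 <= n <= h]. If [n = 0], twisting by [v_(pi i) |-> v_i] would make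
   [M] ordinary. If [g = 1] modulo [p^h], then [g = 1 + p^(h_ij) U_ij] where
   [h_ij] is the least potential of the heights, and [phi(f) = f g] is solved by
   successive approximation in the order of matrices [p^(h_ij) Y_ij], on which
   conjugation by [phi] is bijective, along the filtration by the (phi-invariant)
   valuation for which [M] is isoclinic. *)

Set Implicit Arguments.
Unset Strict Implicit.
Unset Printing Implicit Defensive.

Import Order.TTheory GRing.Theory Num.Theory.
Import VectorInternalTheory.
Local Open Scope ring_scope.

(** * Krull dimension of parametrised sets *)

Section ZariskiChains.
Context (k : fieldType) (n : nat).
Local Open Scope classical_set_scope.
Implicit Types (X Z : set ('I_n -> k)) (f : {mpoly k[n]}).

Lemma zariski_closedP X Z : zariski_closed X Z ->
  Z `<=` X /\ forall x, X x -> ~ Z x ->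
    exists f, (forall z, Z z -> f.@[z] = 0) /\ f.@[x] != 0.
Proof.
move=> [E ->]; split=> [x []//|x Xx /not_andP[]// /existsNP[f]].
move=> /not_implyP[Ef /eqP fx]; exists f; split=> // z [_]; exact.
Qed.

Lemma zariski_closed_zero X Z f : zariski_closed X Z ->
  zariski_closed X (Z `&` [set x | f.@[x] = 0]).
Proof.
move=> [E ->]; exists (E `|` [set f]); rewrite -setIA; congr (_ `&` _).
apply/seteqP; split=> x /=.
  by move=> [Ex fx] g [/Ex|->].
by move=> Ex; split=> [g Eg|]; apply: Ex; [left|right].
Qed.

(** An irreducible closed set covered by the zero loci of two functions lies in one of them, so its
    ring of functions has no zero divisors. *)
Lemma zariski_irreducibleM X Z f g : zariski_irreducible X Z ->
  (forall z, Z z -> f.@[z] * g.@[z] = 0) ->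
  (exists2 z, Z z & f.@[z] != 0) -> forall z, Z z -> g.@[z] = 0.
Proof.
move=> [Zcl _ irr] fg0 [z0 Zz0 fz0] z Zz.
have [|zA|zB] := irr _ _ (zariski_closed_zero f Zcl) (zariski_closed_zero g Zcl).
- by move=> x Zx; have /eqP := fg0 x Zx; rewrite mulf_eq0 => /orP[]/eqP; [left|right].
- by have [_ /eqP] := zA _ Zz0; rewrite (negPf fz0).
- by have [] := zB _ Zz.
Qed.

Lemma has_chain_le X d e : (e <= d)%N -> has_chain X d -> has_chain X e.
Proof.
move=> le_ed [Z [irr lt]]; exists Z; split=> i; first by move/leq_trans/(_ le_ed)/irr.
by move/leq_trans/(_ le_ed)/lt.
Qed.

(** Chains can be truncated, so at most one length satisfies the condition under [xget], whose
    choice is therefore forced. *)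
Lemma zariski_dim_eq X d : has_chain X d -> ~ has_chain X d.+1 ->
  zariski_dim X = d.
Proof.
move=> h h'; rewrite /zariski_dim; case: xgetP => [e _ [he he']|/(_ d)[]//].
by case: (ltngtP e d) => // lt; [case: he'|case: h']; apply: has_chain_le lt _.
Qed.

Definition lin_indep_on (B : finType) (mon : B -> {mpoly k[n]}) Z :=
  forall c : B -> k, (forall x, Z x -> \sum_b c b * (mon b).@[x] = 0) ->
  forall b, c b = 0.

(** The part of a relation of lowest degree in [f] is isolated by dividing by that power of [f],
    which irreducibility of [Z'] allows, and restricting to [Z], where [f] vanishes. *)
Lemma lin_indep_step X Z Z' N f (B : finType) (mon : B -> {mpoly k[n]}) :
  zariski_irreducible X Z' -> Z `<=` Z' -> lin_indep_on mon Z ->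
  (forall z, Z z -> f.@[z] = 0) -> (exists2 z, Z' z & f.@[z] != 0) ->
  lin_indep_on (fun ba : B * 'I_N => mon ba.1 * f ^+ ba.2) Z'.
Proof.
move=> irr sZ indep f0 fn0 c c0 [b a].
have [l] := ubnP (a : nat); elim: l a b => // l IHl a b; rewrite ltnS => le_al.
(* [g] is the relation divided by [f ^ a]; the terms with smaller exponent vanish by induction. *)
pose g := \sum_(ba : B * 'I_N | (a <= ba.2)%N)
  (c ba *: (mon ba.1 * f ^+ (ba.2 - a))).
have fM z : Z' z -> (f ^+ a).@[z] * g.@[z] = 0.
  move=> Zz; rewrite -(c0 _ Zz) [in RHS](bigID (fun ba : B * 'I_N => (a <= ba.2)%N)) /=.
  rewrite [X in _ + X]big1 ?addr0 => [|[b' a'] /=]; last first.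
    rewrite -ltnNge => lt_a; rewrite IHl ?mul0r //; exact: leq_trans lt_a _.
  rewrite -mevalM mulr_sumr raddf_sum; apply: eq_bigr => -[b' a'] /= le.
  by rewrite -scalerAr mevalZ mulrCA -exprD subnKC.
have g0 : forall z, Z' z -> g.@[z] = 0.
  apply: zariski_irreducibleM irr fM _.
  by case: fn0 => z Zz fz; exists z => //; rewrite rmorphXn expf_neq0.
apply: (indep (fun b => c (b, a))) => x Zx.
rewrite -[RHS](g0 x (sZ _ Zx)) [in RHS]raddf_sum /=.
rewrite [RHS](bigID (fun ba : B * 'I_N => ba.2 == a)) /=.
rewrite [X in _ = _ + X]big1 => [|[b' a']]; last first.
  move=> /= /andP[le ne]; rewrite mevalZ mevalM rmorphXn /= f0 // expr0n.
  by rewrite subn_eq0 leqNgt ltn_neqAle le eq_sym ne /= mulr0 mulr0.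
rewrite addr0 [RHS](reindex_onto (fun b => (b, a)) fst) /=; last first.
  by case=> b' a' /= /andP[_ /eqP->].
apply: eq_big => [b'|b' _]; first by rewrite leqnn !eqxx.
by rewrite mevalZ mevalM subnn expr0 meval1 mulr1.
Qed.

End ZariskiChains.

(** * Upper bound for chains: counting independent functions by degree *)

Lemma msizeM_leS (k : idomainType) n (f g : {mpoly k[n]}) s t :
  (msize f <= s.+1)%N -> (msize g <= t.+1)%N -> (msize (f * g) <= (s + t).+1)%N.
Proof.
have [->|f0] := eqVneq f 0; first by rewrite mul0r msize0.
have [->|g0] := eqVneq g 0; first by rewrite mulr0 msize0.
by rewrite msizeM //; lia.
Qed.

Lemma msizeX_leS (k : idomainType) n (f : {mpoly k[n]}) s a :
  (msize f <= s.+1)%N -> (msize (f ^+ a) <= (a * s).+1)%N.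
Proof.
move=> le; elim: a => [|a IHa]; first by rewrite expr0 msize1.
by rewrite exprS mulSn; apply: msizeM_leS.
Qed.

(** Only monomials with all exponents at most [s] occur, so the relation amounts to
    [#|F| * s.+1 ^ d] homogeneous linear equations in [#|B|] unknowns. *)
Lemma mpoly_lin_dep (k : fieldType) (d s : nat) (B F : finType)
    (g : F -> B -> {mpoly k[d]}) :
  (forall c b, msize (g c b) <= s.+1)%N -> (#|F| * s.+1 ^ d < #|B|)%N ->
  exists2 a : B -> k, exists b, a b != 0 & forall c, \sum_b a b *: g c b = 0.
Proof.
move=> gs ltB; pose E := {ffun 'I_d -> 'I_s.+1}.
pose mn (e : E) : 'X_{1..d} := [multinom (e i : nat) | i < d].
have cE : #|{: F * E}| = (#|F| * s.+1 ^ d)%N.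
  by rewrite card_prod card_ffun !card_ord.
pose A : 'M[k]_(#|B|, #|{: F * E}|) := \matrix_(i, j)
  (g (enum_val j).1 (enum_val i))@_(mn (enum_val j).2).
have /rowV0Pn[u /sub_kermxP uA u0] : kermx A != 0.
  rewrite -mxrank_eq0 mxrank_ker -lt0n subn_gt0.
  by apply: leq_ltn_trans (rank_leq_col A) _; rewrite cE.
exists (fun b => u 0 (enum_rank b)) => [|c].
  have [i ui] : exists i, u 0 i != 0 by apply/rV0Pn.
  by exists (enum_val i); rewrite enum_valK.
apply/mpolyP => m; rewrite mcoeff0 raddf_sum /=.
have [/forallP le|/forallPn[j]] := boolP [forall j : 'I_d, m j <= s]%N; last first.
  rewrite -ltnNge => lt; rewrite big1 // => b _; rewrite mcoeffZ.
  rewrite [_@_m]memN_msupp_eq0 ?mulr0 //; apply: msize_mdeg_ge.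
  apply: leq_trans (gs c b) _; apply: leq_trans lt _.
  by rewrite mdegE (bigD1 j) //= leq_addr.
pose e : E := [ffun j => Ordinal (le j : (m j < s.+1)%N)].
have me : mn e = m by apply/mnmP => j; rewrite mnmE ffunE.
have := congr1 (fun v : 'rV_ _ => v 0 (enum_rank (c, e))) uA.
rewrite !mxE (reindex enum_rank) /=; last exact/onW_bij/enum_rank_bij.
move=> uA0; rewrite -[RHS]uA0; apply: eq_bigr => b _.
by rewrite mxE !enum_rankK /= me mcoeffZ.
Qed.

Section UpperBound.
Context (k : fieldType) (n d : nat) (F : finType).
Context (th : F -> n.-tuple {mpoly k[d]}).
Local Open Scope classical_set_scope.
Implicit Types X : set ('I_n -> k).

(** The functions are the [N ^ i] monomials in the first [i] of the [f], with exponents below [N].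
    The degrees of their pullbacks grow only linearly in [N]. *)
Lemma chain_monomials X (e D N : nat) (Z : nat -> set ('I_n -> k))
    (f : nat -> {mpoly k[n]}) :
  (forall i, (i <= e)%N -> zariski_irreducible X (Z i)) ->
  (forall i, (i < e)%N -> Z i `<` Z i.+1) ->
  (forall i, (i < e)%N -> (forall z, Z i z -> (f i).@[z] = 0) /\
     exists2 z, Z i.+1 z & (f i).@[z] != 0) ->
  (forall c i, (i < e)%N -> msize (f i \mPo th c) <= D.+1)%N ->
  forall i, (i <= e)%N -> exists (B : finType) (mon : B -> {mpoly k[n]}),
    [/\ #|B| = (N ^ i)%N, lin_indep_on mon (Z i) &
        forall c b, (msize (mon b \mPo th c) <= (i * (N * D)).+1)%N].
Proof.
move=> irr lt fP fD; elim=> [|i IHi] le_ie.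
  exists unit, (fun=> 1); split=> [|a a0 []|c b]; first by rewrite card_unit.
    have [_ [z Zz] _] := irr 0%N le_ie.
    by have := a0 z Zz; rewrite (big_pred1 tt) => [|[]//]; rewrite meval1 mulr1.
  by rewrite comp_mpoly1 msize1.
have [B [mon [cB indep monD]]] := IHi (ltnW le_ie).
have [f0 fn0] := fP i le_ie.
exists (B * 'I_N)%type, (fun ba : B * 'I_N => mon ba.1 * f i ^+ ba.2); split.
- by rewrite card_prod card_ord cB expnSr.
- by apply: lin_indep_step (irr _ le_ie) _ indep f0 fn0; case: (lt i le_ie).
move=> c [b a] /=; rewrite rmorphM rmorphXn mulSn addnC.
apply: (msizeM_leS (monD c b)).
apply: leq_trans (msizeX_leS a (fD c i le_ie)) _.
by rewrite ltnS leq_mul2r ltnW ?orbT.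
Qed.

(** A longer chain would carry [N ^ d.+1] independent functions, whereas their pullbacks to finitely
    many copies of [d]-space have only [O(N ^ d)] coefficients. *)
Lemma no_chain_param X :
  (forall x, X x -> exists c t, x = fun i => (tnth (th c) i).@[t]) ->
  ~ has_chain X d.+1.
Proof.
move=> Xth [Z [irr lt]].
have exf i : exists f : {mpoly k[n]}, (i < d.+1)%N ->
    (forall z, Z i z -> f.@[z] = 0) /\ exists2 z, Z i.+1 z & f.@[z] != 0.
  have [lid|] := boolP (i < d.+1)%N; last by exists 0.
  have [Zcl _ _] := irr i (ltnW lid).
  have [_ sub] := zariski_closedP Zcl.
  have [sZ nsZ] := lt i lid.
  have /existsNP[z /not_implyP[Zz nZz]] := nsZ.
  have [Z1cl _ _] := irr i.+1 lid; have [ZX _] := zariski_closedP Z1cl.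
  by have [f [f0 fz]] := sub z (ZX _ Zz) nZz; exists f => _; split=> //; exists z.
have [f fP] := choice exf.
pose D := (\max_(c : F) \max_(i < d.+1) msize (f i \mPo th c))%N.
have fD c i : (i < d.+1)%N -> (msize (f i \mPo th c) <= D.+1)%N.
  move=> lid; apply: leqW; apply: leq_trans (leq_bigmax c).
  exact: (@leq_bigmax _ (fun i : 'I_d.+1 => msize (f i \mPo th c)) (Ordinal lid)).
(* [K * N] exceeds the degrees of the pullbacks, and [N] is large enough for
   [#|F| * (K * N) ^ d < N ^ d.+1]. *)
pose K := (d.+1 * D).+1; pose N := (#|F| * K ^ d).+1.
have [B [mon [cB indep monD]]] := chain_monomials N irr lt fP fD (leqnn _).
have [|a [b ab] a0] := mpoly_lin_dep (g := fun c b => mon b \mPo th c) monD.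
  rewrite cB; apply: (@leq_ltn_trans (#|F| * (K * N) ^ d)).
    rewrite leq_mul2l; apply/orP; right.
    have: (d.+1 * (N * D) < K * N)%N by rewrite /K /N; nia.
    by case: (d) => [|d'] // lt1; rewrite leq_exp2r.
  by rewrite expnMn mulnA expnS ltn_mul2r expn_gt0 /= /N ltnSn.
case/eqP: ab; apply: (indep a) => x Xx.
have [Zcl _ _] := irr d.+1 (leqnn _); have [ZX _] := zariski_closedP Zcl.
have [c [t ->]] := Xth x (ZX _ Xx).
have := congr1 (meval t) (a0 c); rewrite meval0 raddf_sum /= => a0t.
rewrite -[RHS]a0t.
by apply: eq_bigr => b' _; rewrite mevalZ comp_mpoly_meval.
Qed.

End UpperBound.

(** * Chains in an embedded principal open set *)

Section LowerBound.
Context (k : closedFieldType).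

(** A root [s] of the nonconstant polynomial ['X * f + 1] satisfies [s * f.[s] = -1]. *)
Lemma poly_nonroot (f : {poly k}) : f != 0 -> exists s, f.[s] != 0.
Proof.
move=> f0; have [|s /rootP] := @closed_rootP k ('X * f + 1) _.
  rewrite size_polyDl; first by rewrite mulrC size_mulX //= eqSS size_poly_eq0.
  by rewrite size_poly1 mulrC size_mulX //= ltnS size_poly_gt0.
rewrite !hornerE => /eqP; rewrite addr_eq0 => /eqP sf1; exists s.
by apply: contra_eq_neq sf1 => /= ->; rewrite mulr0 eq_sym oppr_eq0 oner_eq0.
Qed.

Definition mline d (a b : 'I_d -> k) (g : {mpoly k[d]}) : {poly k} :=
  mmap polyC (fun i => (a i)%:P + (b i - a i) *: 'X) g.

Lemma mlineE d (a b : 'I_d -> k) (g : {mpoly k[d]}) s :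
  (mline a b g).[s] = g.@[fun i => a i + (b i - a i) * s].
Proof.
rewrite /mline /mmap mevalE horner_sum; apply: eq_bigr => m _.
rewrite hornerM hornerC /mmap1 horner_prod; congr (_ * _).
by apply: eq_bigr => i _; rewrite horner_exp !hornerE.
Qed.

(** The restrictions of [f] and [g] to the line through [a] and [b] are nonzero at the parameters 0
    and 1, so their product is a nonzero polynomial in one variable. *)
Lemma line_nonzero d (a b : 'I_d -> k) (f g : {mpoly k[d]}) :
  f.@[a] != 0 -> g.@[b] != 0 ->
  exists2 s, f.@[fun i => a i + (b i - a i) * s] != 0 &
             g.@[fun i => a i + (b i - a i) * s] != 0.
Proof.
move=> fa gb; have [|s] := @poly_nonroot (mline a b f * mline a b g).
  rewrite mulf_eq0; apply/norP; split.
    apply: contraNneq fa => f0; rewrite -[X in _ == X](horner0 0) -f0 mlineE.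
    by rewrite (_ : (fun i => _) = a) //; apply/funext => i; rewrite mulr0 addr0.
  apply: contraNneq gb => g0; rewrite -[X in _ == X](horner0 1) -g0 mlineE.
  rewrite (_ : (fun i => _) = b) //; apply/funext => i.
  by rewrite mulr1 addrC subrK.
by rewrite hornerM mulf_eq0 !mlineE => /norP[]; exists s.
Qed.

Section Chain.
Context (n d : nat) (X : set ('I_n -> k)).
Context (th : n.-tuple {mpoly k[d]}) (rho : d.-tuple {mpoly k[n]}).
Context (q : {mpoly k[d]}).
Local Open Scope classical_set_scope.
Let Th (t : 'I_d -> k) : 'I_n -> k := fun i => (tnth th i).@[t].
Let Rho (x : 'I_n -> k) : 'I_d -> k := fun i => (tnth rho i).@[x].

(** [Th] embeds the open set [q != 0] of [d]-space into [X], with polynomial retraction [Rho]. The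
    chain is formed by the images of the coordinate subspaces; their irreducibility is tested on
    lines. *)
Lemma has_chain_param :
  (forall t, Rho (Th t) = t) -> (forall t, X (Th t) <-> q.@[t] != 0) ->
  q.@[fun=> 0] != 0 -> has_chain X d.
Proof.
move=> RhoK XP q0.
pose S (i : nat) := [set t : 'I_d -> k | forall j : 'I_d, (i <= j)%N -> t j = 0].
pose Z i := [set Th t | t in S i `&` [set t | q.@[t] != 0]].
have S_line i t u s : S i t -> S i u -> S i (fun j => t j + (u j - t j) * s).
  by move=> St Su j le; rewrite St // Su // subr0 mul0r addr0.
(* The origin lies in [S i] and satisfies [q != 0], so the line from 0 to [t] contains a suitable
   point. *)
have dense i t (f : {mpoly k[d]}) : S i t -> f.@[t] != 0 ->
    exists u, [/\ S i u, q.@[u] != 0 & f.@[u] != 0].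
  move=> St ft; have [s qs fs] := line_nonzero q0 ft.
  by eexists; split; [|exact: qs|exact: fs]; apply: S_line.
have pull (f : {mpoly k[n]}) t : (f \mPo th).@[t] = f.@[Th t].
  by rewrite comp_mpoly_meval.
have Zcl i : zariski_closed X (Z i).
  (* Among the polynomials vanishing on [Z i] are the equations of [Th \o Rho = id] and the
     components of [Rho] of index at least [i]; together they recover a preimage in [S i]. *)
  exists [set f | forall x, Z i x -> f.@[x] = 0].
  apply/seteqP; split=> [x Zx|x [Xx Ix]].
    by split=> [|f]; [case: Zx => t [_ qt] <-; apply/XP | apply].
  have ThR : Th (Rho x) = x.
    apply/funext => l; apply/eqP; rewrite -subr_eq0; apply/eqP.
    have := Ix ((tnth th l \mPo rho) - 'X_l).
    rewrite mevalB mevalXU comp_mpoly_meval; apply=> y [t _ <-].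
    rewrite mevalB mevalXU comp_mpoly_meval -/(Rho (Th t)) RhoK.
    exact: subrr.
  exists (Rho x) => //; split=> [j le|]; last by apply/XP; rewrite ThR.
  apply: (Ix (tnth rho j)) => y [t [St _] <-].
  by have /(congr1 (fun f => f j)) := RhoK t; rewrite /Rho => ->; apply: St.
exists Z; split=> [i le|i lt].
  split=> //; first by exists (Th (fun=> 0)), (fun=> 0).
  move=> A B /zariski_closedP[_ sepA] /zariski_closedP[_ sepB] ZAB.
  apply/or_asboolP; apply/negPn/negP; rewrite negb_or => /andP[].
  move=> /asboolPn/existsNP[x /not_implyP[Zx nAx]].
  move=> /asboolPn/existsNP[y /not_implyP[Zy nBy]].
  have [t [St qt] tx] := Zx; have [u [Su qu] uy] := Zy.
  have [|f [fA fx]] := sepA x _ nAx; first by rewrite -tx; apply/XP.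
  have [|g [gB gy]] := sepB y _ nBy; first by rewrite -uy; apply/XP.
  rewrite -tx -pull in fx; rewrite -uy -pull in gy.
  have [s fs gs] := line_nonzero fx gy.
  set w := (fun j => _) in fs gs.
  have Sw : S i w by apply: S_line.
  have fgw : ((f \mPo th) * (g \mPo th)).@[w] != 0 by rewrite mevalM mulf_neq0.
  have [v [Sv qv]] := dense i w _ Sw fgw.
  rewrite mevalM mulf_eq0 !pull => /norP[fv gv].
  have [|/fA fv0|/gB gv0] := ZAB (Th v); first by exists v.
    by rewrite fv0 eqxx in fv.
  by rewrite gv0 eqxx in gv.
split=> [x [t [St qt] <-]|sub].
  by exists t => //; split=> // j ltij; apply: St; apply: ltnW.
pose j0 := Ordinal lt.
have [||u [Su qu]] := dense i.+1 (fun j => (j == j0)%:R) 'X_j0.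
- by move=> j; case: eqP => // -> /=; rewrite ltnn.
- by rewrite mevalXU eqxx oner_eq0.
rewrite mevalXU => uj.
have [|t [St qt] tu] := sub (Th u); first by exists u.
have := congr1 Rho tu; rewrite !RhoK => tu'.
by case/eqP: uj; rewrite -tu' St.
Qed.

End Chain.
End LowerBound.

(** * Witt vectors *)

Definition vshift (R : nmodType) (x : nat -> R) (n : nat) : R :=
  if n is n'.+1 then x n' else 0.

Section WittSequences.
Context (p : nat) (p_prime : prime p).

Lemma zpoly_ghost_inj (I : choiceType) : injective (ghost p (R := zpoly I)).
Proof.
move=> a b eq_ab; apply: (ghost_inj p_prime (divn_ := zdivn)).
  by move=> n f; exact: zdivnK.
by rewrite eq_ab.
Qed.

Lemma ghost0 (R : comNzRingType) (x : nat -> R) : ghost p x 0 = x 0%N.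
Proof. by rewrite /ghost big_ord1 expr1. Qed.

Lemma wadd_coef0 (R : comNzRingType) (x y : nat -> R) :
  wadd p x y 0%N = x 0%N + y 0%N.
Proof. by have := ghost_wadd p_prime x y 0; rewrite !ghost0. Qed.

Lemma wmul_coef0 (R : comNzRingType) (x y : nat -> R) :
  wmul p x y 0%N = x 0%N * y 0%N.
Proof. by have := ghost_wmul p_prime x y 0; rewrite !ghost0. Qed.

Lemma wopp_coef0 (R : comNzRingType) (x : nat -> R) :
  wopp p x 0%N = - x 0%N.
Proof. by have := ghost_wopp p_prime x 0; rewrite !ghost0. Qed.

Lemma exp0_ppow (R : pzSemiRingType) m : 0 ^+ (p ^ m) = 0 :> R.
Proof. by rewrite expr0n expn_eq0 -leqn0 leqNgt prime_gt0. Qed.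

(* Both sides have the same ghost components once lifted to a torsion-free ring
   by a pair of sequences that still have disjoint supports. *)
Lemma wadd_disjoint (R : comNzRingType) (x y : nat -> R) :
  (forall n, x n = 0 \/ y n = 0) -> wadd p x y = fun n => x n + y n.
Proof.
move=> dis; pose b n := `[< y n = 0 >].
pose h := zeval (fun n => if b n then x n else y n).
pose x' n : zpoly nat := if b n then zvar n else 0.
pose y' n : zpoly nat := if b n then 0 else zvar n.
have hx : h \o x' = x.
  apply/funext => n; change (h (x' n) = x n); rewrite /x'; case: ifP => bn; last first.
    by rewrite (rmorph0 h); case: (dis n) => // /asboolP; rewrite -/(b n) bn.
  by rewrite zeval_var bn.
have hy : h \o y' = y.
  apply/funext => n; change (h (y' n) = y n); rewrite /y'; case: ifP => bn.
    by rewrite (rmorph0 h); move/asboolP: bn.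
  by rewrite zeval_var bn.
suff: wadd p x' y' = fun n => x' n + y' n.
  move/(congr1 (fun f => h \o f)); rewrite wadd_morph hx hy => ->.
  by rewrite -hx -hy; apply/funext => n; exact: (rmorphD h).
apply: zpoly_ghost_inj; apply/funext => n; rewrite ghost_wadd // /ghost -big_split.
apply: eq_bigr => i _ /=; rewrite -mulrnDl /x' /y'; case: ifP => _.
  by rewrite exp0_ppow !addr0.
by rewrite exp0_ppow !add0r.
Qed.

Lemma ghost_vshift (R : comNzRingType) (x : nat -> R) n :
  ghost p (vshift x) n = vshift (ghost p x) n *+ p.
Proof.
case: n => [|n]; first by rewrite ghost0 mul0rn.
rewrite /ghost big_ord_recl /= exp0_ppow mul0rn add0r -sumrMnl.
by apply: eq_bigr => i _; rewrite /bump /= add1n subSS expnSr mulrnA.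
Qed.

Lemma vshift_morph (R S : nmodType) (h : {additive R -> S}) (x : nat -> R) :
  h \o vshift x = vshift (h \o x).
Proof. by apply/funext => -[|n] //=; rewrite raddf0. Qed.

Lemma wadd_vshift (R : comNzRingType) (x y : nat -> R) :
  wadd p (vshift x) (vshift y) = vshift (wadd p x y).
Proof.
have [A [h [x' [y' [_ [inj <- <- _]]]]]] := witt_lift p_prime x y x.
rewrite -!(vshift_morph h) -!wadd_morph -(vshift_morph h); congr (_ \o _).
apply/inj/funext => n; rewrite ghost_wadd // !ghost_vshift -mulrnDl.
by case: n => [|n] /=; rewrite ?addr0 ?ghost_wadd.
Qed.

Lemma ghost_natmul (R : comNzRingType) (x : nat -> R) m n :
  ghost p (iter m (wadd p x) (@wzero R)) n = ghost p x n *+ m.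
Proof.
elim: m => [|m IHm]; first by rewrite ghost_wzero.
by rewrite iterS ghost_wadd // IHm mulrS.
Qed.

Lemma ghost_recr (R : pzSemiRingType) (x : nat -> R) m :
  ghost p x m.+1 = ghost p (fun i => x i ^+ p) m + x m.+1 *+ p ^ m.+1.
Proof.
rewrite {1}/ghost big_ord_recr /= subnn expr1; congr (_ + _).
by apply: eq_bigr => i _; rewrite -exprM -expnS -subSn // -ltnS.
Qed.

(* Multiplication by [p] is [V F], up to [p]: the ghost components of the two
   sides differ by [p ^ n.+1 x_n]. *)
Lemma wmulp_torsionfree (R : comNzRingType) (x : nat -> R) n :
  (forall m, (0 < m)%N -> injective (fun f : R => f *+ m)) ->
  exists g, iter p (wadd p x) (@wzero R) n =
            vshift (fun i => x i ^+ p) n + g *+ p.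
Proof.
move=> torsionfree; set s := iter _ _ _; set t := vshift _.
have st m : ghost p s m = ghost p t m + x m *+ p ^ m.+1.
  rewrite ghost_natmul ghost_vshift expnSr mulrnA -mulrnDl; congr (_ *+ p).
  case: m => [|m] /=; first by rewrite ghost0 add0r.
  exact: ghost_recr.
elim/ltn_ind: n => n IHn.
have ex (i : 'I_n) : exists d, s i ^+ (p ^ (n - i)) *+ p ^ i =
    t i ^+ (p ^ (n - i)) *+ p ^ i + d *+ p ^ n.+1.
  have [g /expr_congr-/(_ p_prime (n - i)%N)[d ->]] := IHn _ (ltn_ord i).
  by exists d; rewrite mulrnDl -mulrnA -expnD addSn subnK // ltnW.
have [d dP] := choice ex.
exists (x n - \sum_i d i); apply: (torsionfree (p ^ n)%N).
  by rewrite expn_gt0 prime_gt0.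
move: (st n); rewrite /ghost !big_ord_recr /= subnn !expr1.
rewrite (eq_bigr _ (fun i _ => dP i)) big_split /= -addrA -[RHS]addrA.
move/addrI=> eq_n; rewrite /= mulrnDl -mulrnA -expnS mulrnBl -sumrMnl.
apply: (addrI (\sum_i d i *+ p ^ n.+1)).
by rewrite eq_n [RHS]addrCA [X in _ = _ + X]addrC subrK.
Qed.

Lemma wadd_iter_morph (R S : comNzRingType) (h : {rmorphism R -> S}) x m :
  h \o iter m (wadd p x) (@wzero R) = iter m (wadd p (h \o x)) (@wzero S).
Proof. by elim: m => [|m IHm]; rewrite ?wzero_morph // !iterS wadd_morph IHm. Qed.

Lemma wmulp_lift (A R : comNzRingType) (h : {rmorphism A -> R}) (x : nat -> A) :
  (forall m, (0 < m)%N -> injective (fun f : A => f *+ m)) -> p \in [pchar R] ->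
  iter p (wadd p (h \o x)) (@wzero R) = vshift (fun i => h (x i) ^+ p).
Proof.
move=> torsionfree pcharR; rewrite -wadd_iter_morph; apply/funext => n /=.
have [g ->] := wmulp_torsionfree x n torsionfree.
rewrite rmorphD rmorphMn /= -[(_ : R) *+ p]mulr_natr pcharf0 // mulr0 addr0.
by case: n => [|n] /=; rewrite ?rmorph0 ?rmorphXn.
Qed.

(** The generic vector over integer polynomials is torsion-free and specialises to [x]; the error, a
    multiple of [p], dies in characteristic [p]. *)
Lemma wmulp (R : comNzRingType) (x : nat -> R) : p \in [pchar R] ->
  iter p (wadd p x) (@wzero R) = vshift (fun i => x i ^+ p).
Proof.
move=> pcharR; have := wmulp_lift (zeval x) zvar (@zpoly_mulrnI nat) pcharR.
have -> : zeval x \o zvar = x by apply/funext => n; exact: zeval_var.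
by move=> ->; congr vshift; apply/funext => n; rewrite zeval_var.
Qed.

End WittSequences.

Definition seq_trunc (R : nmodType) n (x : nat -> R) : nat -> R :=
  fun i => if (i < n)%N then x i else 0.

(** Dependent choice for Witt vectors built one coordinate at a time: the condition on coordinate
    [n] sees the previous ones, extended by 0. *)
Lemma dependent_seq (T : nmodType) (Q : nat -> (nat -> T) -> T -> Prop) :
  (forall n x, exists a, Q n x a) ->
  exists x, forall n, Q n (seq_trunc n x) (x n).
Proof.
move=> ex; have [c cP] := choice (fun nx : nat * (nat -> T) => ex nx.1 nx.2).
pose fix pre n : seq T := if n is n'.+1 then
  rcons (pre n') (c (n', fun i => (pre n')`_i)) else [::].
have size_pre n : size (pre n) = n by elim: n => //= n IHn; rewrite size_rcons IHn.
pose x n := (pre n.+1)`_n.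
have nth_pre n i : (i < n)%N -> (pre n)`_i = x i.
  elim: n => // n IHn; rewrite ltnS leq_eqVlt => /orP[/eqP -> // | lt_in].
  by rewrite -(IHn lt_in) [LHS]nth_rcons size_pre lt_in.
exists x => n; have := cP (n, fun i => (pre n)`_i).
congr (Q n _ _); last by rewrite /x /= nth_rcons size_pre ltnn eqxx.
apply/funext => i; rewrite /seq_trunc /=; case: ltnP => [/nth_pre->//|le].
by rewrite nth_default // size_pre.
Qed.

(** * Congruences and successive approximation over an algebraically closed field *)

Section WittField.
Context (k : closedFieldType) (p : nat) (pchark : p \in [pchar k]).
Local Notation W := (witt pchark).
Local Notation Wt := (Witt pchark).
Implicit Types x y z : W.
Let p_pr : prime p := pcharf_prime pchark.

Lemma witt_coefP x y : (forall n, x n = y n) <-> x = y.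
Proof. by split=> [e|->//]; apply/witt_ext/funext. Qed.

Lemma wcoefD x y : wcoef (x + y) = wadd p x y. Proof. by []. Qed.
Definition wred (x : W) : k := x 0%N.

Fact wred_is_zmod_morphism : zmod_morphism wred.
Proof.
move=> x y; apply: etrans (wadd_coef0 p_pr _ _) _.
by congr (_ + _); apply: (wopp_coef0 p_pr).
Qed.
Fact wred_is_monoid_morphism : monoid_morphism wred.
Proof. by split=> [|x y] //; apply: (wmul_coef0 p_pr). Qed.
HB.instance Definition _ :=
  GRing.isZmodMorphism.Build W k wred wred_is_zmod_morphism.
HB.instance Definition _ :=
  GRing.isMonoidMorphism.Build W k wred wred_is_monoid_morphism.

Lemma wcoef0D x y : (x + y) 0%N = x 0%N + y 0%N. Proof. exact: (rmorphD wred). Qed.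
Lemma wcoef0M x y : (x * y) 0%N = x 0%N * y 0%N. Proof. exact: (rmorphM wred). Qed.

Definition wV (x : W) : W := Wt (vshift x).
Definition wtrunc n (x : W) : W := Wt (seq_trunc n x).
Definition wdrop n (x : W) : W := Wt (fun i => x (i + n)%N).

Lemma wVD x y : wV (x + y) = wV x + wV y.
Proof. by apply/witt_ext; rewrite wcoefD /= wadd_vshift. Qed.

Lemma iter_wVD n x y : iter n wV (x + y) = iter n wV x + iter n wV y.
Proof. by elim: n => // n IHn; rewrite !iterS IHn wVD. Qed.

Lemma iter_wVE n x l : iter n wV x l = if (l < n)%N then 0 else x (l - n)%N.
Proof.
elim: n l => [|n IHn] l; first by rewrite subn0.
by case: l => [|l] //; rewrite iterS /= IHn ltnS subSS.
Qed.

Lemma witt_split n x : x = wtrunc n x + iter n wV (wdrop n x).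
Proof.
apply/witt_ext; rewrite wcoefD wadd_disjoint //= => [|l]; last first.
  by rewrite iter_wVE /seq_trunc; case: ltnP; [right|left].
apply/funext => l; rewrite iter_wVE /seq_trunc /=.
by case: ltnP => [|le]; rewrite ?addr0 // subnK // add0r.
Qed.

(** The truncation of [x] and the shifted sum of the tails have disjoint supports, so adding them
    involves no carry. *)
Lemma wtruncD_coef n x z l :
  (x + iter n wV z) l = if (l < n)%N then x l else
    (wdrop n x + z) (l - n)%N.
Proof.
rewrite {1}(witt_split n x) -addrA -iter_wVD.
set u := _ + z; rewrite wcoefD wadd_disjoint //= => [|j]; last first.
  by rewrite iter_wVE /seq_trunc; case: ltnP; [right|left].
rewrite iter_wVE /seq_trunc /=; case: ltnP => lt; first by rewrite addr0.
by rewrite add0r.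
Qed.

Lemma wnatmul_coef x m : wcoef (x *+ m) = iter m (wadd p x) (@wzero k).
Proof. by elim: m => // m IHm; rewrite mulrS wcoefD IHm. Qed.

Local Notation sigma := (@wfrob k p pchark).

Lemma wmulpE x : p%:R * x = wV (sigma x).
Proof. by rewrite mulr_natl; apply/witt_ext; rewrite wnatmul_coef wmulp. Qed.

Lemma wfrobX_coef r x l : iter r sigma x l = x l ^+ (p ^ r).
Proof. by elim: r => [|r IHr]; rewrite ?expr1 // iterS /= IHr -exprM -expnSr. Qed.

Lemma sigma_wV x : sigma (wV x) = wV (sigma x).
Proof.
apply/witt_coefP => -[|l] //=; rewrite expr0n.
by case: (p) p_pr.
Qed.

Lemma wmulpXE n x : p%:R ^+ n * x = iter n wV (iter n sigma x).
Proof.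
elim: n x => [|n IHn] x; first by rewrite mul1r.
rewrite exprSr -mulrA IHn wmulpE !iterSr; congr (iter _ _ _).
by elim: n {IHn} => //= n ->; rewrite sigma_wV.
Qed.

Lemma wmulpX_coef n x l :
  (p%:R ^+ n * x) l = if (l < n)%N then 0 else x (l - n)%N ^+ (p ^ n).
Proof. by rewrite wmulpXE iter_wVE wfrobX_coef. Qed.

Lemma ppower_inj n : injective (fun a : k => a ^+ (p ^ n)).
Proof.
elim: n => [|n IHn] a b /=; first by rewrite !expr1.
rewrite !expnSr !exprM -!(pFrobenius_autE pchark) => /(fmorph_inj _).
exact: IHn.
Qed.

Lemma ppower_surj n (a : k) : exists b, b ^+ (p ^ n) = a.
Proof.
have [|b /rootP] := @closed_rootP k ('X^(p ^ n) - a%:P) _.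
  by rewrite size_XnsubC ?expn_gt0 ?prime_gt0 // eqSS -lt0n expn_gt0 prime_gt0.
by rewrite !hornerE => /eqP; rewrite subr_eq0 => /eqP; exists b.
Qed.

(** [p ^ n] is [V ^ n F ^ n], and Frobenius is onto because [k] is perfect. *)
Lemma wV_mulp n x : exists y, iter n wV x = p%:R ^+ n * y.
Proof.
have [c cP] := choice (fun l => ppower_surj n (x l)).
exists (Wt c); rewrite wmulpXE; congr (iter _ _ _).
by apply/witt_coefP => l; rewrite wfrobX_coef /= cP.
Qed.

Definition wcong n x y := forall l, (l < n)%N -> x l = y l.

Lemma wcongP n x y : wcong n x y <-> exists h, x = y + p%:R ^+ n * h.
Proof.
split=> [e|[h ->] l lt]; last by rewrite wmulpXE wtruncD_coef lt.
have [h hE] := wV_mulp n (wdrop n x - wdrop n y); exists h.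
rewrite -hE [LHS](witt_split n x) [X in _ = X + _](witt_split n y).
rewrite -addrA -iter_wVD; congr (_ + iter _ _ _).
  by apply/witt_coefP => l /=; rewrite /seq_trunc; case: ltnP => // /e.
by rewrite addrCA subrr addr0.
Qed.

(** Coordinate [n] of [x] enters additively in coordinate [n] of the sum. With the analogue for
    products, this lets equations over [W] be solved one coordinate at a time. *)
Lemma wcoefD_last n x y : (x + y) n = (wtrunc n x + y) n + x n.
Proof.
rewrite {1}(witt_split n x) addrAC.
rewrite wtruncD_coef ltnn subnn.
by rewrite wcoef0D /= !add0n.
Qed.

(** The discarded tail of [y] is some [p ^ n * h]; coordinate [n] of its product with [x] is the
    [p ^ n]-th power of [x 0 * h 0]. *)
Lemma wcoefM_last n x y : (x * y) n = (x * wtrunc n y) n + x 0%N ^+ (p ^ n) * y n.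
Proof.
rewrite {1}(witt_split n y) mulrDr.
have [h hE] := wV_mulp n (wdrop n y).
have h0 : h 0%N ^+ (p ^ n) = y n.
  have := congr1 (fun x : W => x n) hE.
  by rewrite iter_wVE wmulpX_coef ltnn subnn /= add0n => <-.
rewrite hE mulrCA wmulpXE wtruncD_coef ltnn subnn.
by rewrite wcoef0D /= add0n wfrobX_coef wcoef0M exprMn h0.
Qed.

Lemma witt_unit x : x 0%N != 0 -> exists y, y * x = 1.
Proof.
move=> x0; pose Q n (y : nat -> k) a :=
  (x * Wt y) n + x 0%N ^+ (p ^ n) * a = (1 : W) n.
have [|y yP] := @dependent_seq k Q.
  move=> n y; exists (x 0%N ^- (p ^ n) * ((1 : W) n - (x * Wt y) n)).
  by rewrite /Q mulVKf ?expf_neq0 // addrC subrK.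
exists (Wt y); rewrite mulrC; apply/witt_coefP => n.
by rewrite wcoefM_last -[RHS]yP.
Qed.

Lemma artin_schreier r (c : k) : (0 < r)%N -> exists a, a ^+ (p ^ r) = a + c.
Proof.
move=> r0; have pr : (1 < p ^ r)%N by rewrite -(expn0 p) ltn_exp2l ?prime_gt1.
have [|a /rootP] := @closed_rootP k ('X^(p ^ r) - ('X + c%:P)) _.
  rewrite size_polyDl size_polyXn; first by rewrite eqSS -lt0n ltnW.
  by rewrite size_polyN size_XaddC.
by rewrite !hornerE => /eqP; rewrite subr_eq0 => /eqP; exists a.
Qed.

Lemma witt_artin_schreier r c : (0 < r)%N -> exists y, iter r sigma y = y + c.
Proof.
move=> r0; pose Q n (y : nat -> k) a := a ^+ (p ^ r) = a + (Wt y + c) n.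
have [|y yP] := @dependent_seq k Q.
  by move=> n y; apply: artin_schreier.
exists (Wt y); apply/witt_coefP => n.
by rewrite wfrobX_coef wcoefD_last addrC; apply: yP.
Qed.

Lemma witt_complete (x : nat -> W) :
  (forall n, wcong n (x n.+1) (x n)) -> exists y, forall n, wcong n y (x n).
Proof.
move=> cau; exists (Wt (fun n => x n.+1 n)).
have cst n l d : (l < n)%N -> x (n + d)%N l = x n l.
  by move=> lt; elim: d => [|d IHd]; rewrite ?addn0 // addnS cau ?IHd // ltn_addr.
by move=> n l lt /=; rewrite -(subnKC lt) cst.
Qed.

End WittField.

(** * Excursions of the height function *)

Section Heights.
Context (r : nat) (pi : 'S_r) (e : 'I_r -> nat).
Hypothesis e_le1 : forall i, (e i <= 1)%N.
Hypothesis pi_cycle : forall i j, j \in porbit pi i.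

Local Notation T := ('I_r * 'I_r)%type.
Implicit Types z : T.

Definition pair_map (z : T) : T := (pi z.1, pi z.2).
Local Notation tau := pair_map.
Definition slope_diff (z : T) : int := (e z.2)%:Z - (e z.1)%:Z.
Local Notation eps := slope_diff.
Definition height (z : T) (u : nat) : int := \sum_(w < u) eps (iter w tau z).
Local Notation ht := height.

Lemma tau_inj : injective tau.
Proof. by move=> [a b] [c d] [/perm_inj -> /perm_inj ->]. Qed.

Lemma iter_tau u i j : iter u tau (i, j) = (iter u pi i, iter u pi j).
Proof. by elim: u => // u IHu; rewrite !iterS IHu. Qed.

Lemma iter_tau_inj u : injective (iter u tau).
Proof. by elim: u => // u IHu z z' /tau_inj/IHu. Qed.

Lemma card_porbit_cycle i : #|porbit pi i| = r.
Proof.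
rewrite -[RHS]card_ord -cardsT; congr #|pred_of_set _|.
by apply/setP => j; rewrite inE pi_cycle.
Qed.

Lemma iter_pi_r i : iter r pi i = i.
Proof. by have := iter_porbit pi i; rewrite card_porbit_cycle. Qed.

Lemma iter_tau_r z : iter r tau z = z.
Proof. by case: z => i j; rewrite iter_tau !iter_pi_r. Qed.

Lemma iter_tau_mul u z : iter (u * r) tau z = z.
Proof. by elim: u => // u IHu; rewrite mulSn iterD IHu iter_tau_r. Qed.

Lemma r_gt0 z : (0 < r)%N.
Proof. by case: (r) (z.1) => [[]|]. Qed.

Lemma iter_tauK u z : exists v, iter v tau (iter u tau z) = z.
Proof.
exists (u * r - u)%N; rewrite -iterD subnK ?iter_tau_mul //.
by rewrite leq_pmulr ?(r_gt0 z).
Qed.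

Lemma ht0 z : ht z 0 = 0. Proof. exact: big_ord0. Qed.

Lemma htD z u v : ht z (u + v) = ht z u + ht (iter u tau z) v.
Proof.
rewrite /ht big_split_ord; congr (_ + _); apply: eq_bigr => w _.
by rewrite /= addnC iterD.
Qed.

Lemma ht1 z : ht z 1 = eps z. Proof. by rewrite /ht big_ord1. Qed.

Lemma htS z u : ht z u.+1 = ht z u + eps (iter u tau z).
Proof. by rewrite -addn1 htD ht1. Qed.

Lemma htSl z u : ht z u.+1 = eps z + ht (tau z) u.
Proof. by rewrite -add1n htD ht1. Qed.

Lemma sum_cycle i : (\sum_(w < r) (e (iter w pi i))%:Z = \sum_j (e j)%:Z)%R.
Proof.
pose s := traject pi i r.
have ps : perm_eq s (enum 'I_r).
  apply: uniq_perm (enum_uniq _) _ => [|j].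
    by have := uniq_traject_porbit pi i; rewrite card_porbit_cycle.
  by have := porbit_traject pi i j; rewrite card_porbit_cycle pi_cycle mem_enum.
have -> : \sum_j (e j)%:Z = \sum_(j <- enum 'I_r) (e j)%:Z by rewrite big_enum.
rewrite -(perm_big _ ps) /= [RHS](big_nth i) /s size_traject big_mkord.
by apply: eq_bigr => w _; rewrite nth_traject.
Qed.

(** Both indices run exactly once through the whole cycle, so the two sums of [e] cancel. *)
Lemma ht_r z : ht z r = 0.
Proof.
case: z => i j; rewrite /ht -[RHS](subrr (\sum_j (e j)%:Z)).
rewrite -{1}(sum_cycle j) -(sum_cycle i) -sumrB.
by apply: eq_bigr => w _; rewrite iter_tau.
Qed.

Lemma htDr z u : ht z (r + u) = ht z u.
Proof. by rewrite htD ht_r iter_tau_r add0r. Qed.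

Lemma ht_mod z u : ht z u = ht z (u %% r).
Proof.
rewrite {1}(divn_eq u r); elim: (u %/ r)%N => // q IHq.
by rewrite mulSn -addnA htDr.
Qed.

Lemma eps_bound z : (-1 <= eps z <= 1).
Proof. by rewrite /eps; have := e_le1 z.1; have := e_le1 z.2; lia. Qed.

(** Discrete intermediate value theorem: heights move by at most 1 per step. *)
Lemma ht_cross_up z c a b : (a <= b)%N -> ht z a <= c -> c <= ht z b ->
  exists w, [/\ (a <= w)%N, (w <= b)%N & ht z w = c].
Proof.
elim: b => [|b IHb] le ha hb.
  by exists a; split=> //; move: le ha hb; rewrite leqn0 => /eqP->; lia.
have [eq_a|ne] := eqVneq a b.+1.
  by exists a; split=> //; rewrite eq_a in ha *; lia.
have [hb'|lt] := lerP c (ht z b).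
  have [|w [wa wb wc]] := IHb _ ha hb'; first by lia.
  by exists w; split=> //; lia.
exists b.+1; split=> //; have := eps_bound (iter b tau z).
by rewrite htS in hb *; lia.
Qed.

Lemma ht_cross_down z c a b : (a <= b)%N -> c <= ht z a -> ht z b <= c ->
  exists w, [/\ (a <= w)%N, (w <= b)%N & ht z w = c].
Proof.
elim: b => [|b IHb] le ha hb.
  by exists a; split=> //; move: le ha hb; rewrite leqn0 => /eqP->; lia.
have [eq_a|ne] := eqVneq a b.+1.
  by exists a; split=> //; rewrite eq_a in ha *; lia.
have [hb'|lt] := lerP (ht z b) c.
  have [|w [wa wb wc]] := IHb _ ha hb'; first by lia.
  by exists w; split=> //; lia.
exists b.+1; split=> //; have := eps_bound (iter b tau z).
by rewrite htS in hb *; lia.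
Qed.

(* The strict bound forces [ht z 1 = -1]. *)
Definition excursion (m : nat) (z : T) (s : nat) :=
  [/\ (1 < s)%N, ht z s = 0 &
      forall u, (0 < u < s)%N -> - m%:Z <= ht z u < 0].
Definition free_pair (m : nat) (z : T) := exists s, excursion m z s.
Definition free_pairs (m : nat) : {set T} := [set z | `[< free_pair m z >]].
Definition deep_pairs (m : nat) := free_pairs m :\: free_pairs m.-1.

Lemma free_pairsP m z : reflect (free_pair m z) (z \in free_pairs m).
Proof. by rewrite inE; apply: asboolP. Qed.

(** A shallower excursion from [z] also ends at a zero of the height, hence not before [s], and
    would pass through [u]. *)
Lemma excursion_deep m z s u : excursion m z s -> (u < s)%N ->
  ht z u = - m%:Z -> (0 < m)%N -> z \in deep_pairs m.
Proof.
move=> [s1 hs bs] us hu m0; rewrite inE; apply/andP; split; last first.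
  by apply/free_pairsP; exists s.
apply/free_pairsP => -[s' [s1' hs' bs']].
have u0 : (0 < u)%N by case: u hu {us} => // ; rewrite ht0; lia.
have [lt|le] := ltnP u s'.
  by have := bs' u; rewrite u0 lt hu => /(_ isT); lia.
by have := bs s'; rewrite hs' (ltnW s1') (leq_ltn_trans le us) => /(_ isT); lia.
Qed.

Lemma deep_excursion m z : z \in deep_pairs m ->
  exists s u, [/\ excursion m z s, (0 < u < s)%N, ht z u = - m%:Z & (0 < m)%N].
Proof.
rewrite inE => /andP[/free_pairsP nfree /free_pairsP[s exc]].
have [s1 hs bs] := exc; have b1 := bs 1%N; rewrite s1 in b1.
have {}b1 := b1 isT.
have m0 : (0 < m)%N by lia.
apply: contrapT => /forallNP/(_ s)/forallNP nu; apply: nfree; exists s; split=> // u us.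
have := bs u us; have: ht z u <> - m%:Z by move=> hu; apply: (nu u).
by lia.
Qed.

(** Negativity on the whole descent is what makes [z] recoverable from the node reached. *)
Definition is_child z v := ht z v = -1 /\ forall w, (0 < w <= v)%N -> ht z w < 0.

Lemma deep_child m z : (0 < m)%N -> z \in deep_pairs m.+1 ->
  exists v, [/\ (0 < v)%N, is_child z v & iter v tau z \in deep_pairs m].
Proof.
move=> m0 /deep_excursion[s [u [[s1 hs bs] /andP[u0 us] hu _]]].
have b1 := bs 1%N; rewrite s1 in b1; have {}b1 := b1 isT.
have h1 : ht z 1 = -1 by have := eps_bound z; move: b1; rewrite ht1; lia.
pose Pv v := [&& (0 < v)%N, (v <= u)%N & ht z v == -1].
have exv : exists v, Pv v by exists 1%N; rewrite /Pv u0 h1 eqxx.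
have ubv v : Pv v -> (v <= u)%N by case/and3P.
have [v /and3P[v0 vu /eqP hv] vmax] := ex_maxnP exv ubv.
have belowu w : (v < w <= u)%N -> ht z w < -1.
  move=> /andP[vw wu]; rewrite ltNge; apply/negP => hw.
  have [|x [wx xu hx]] := @ht_cross_down z (-1) w u wu hw; first by lia.
  have : (x <= v)%N by apply: vmax; rewrite /Pv hx eqxx xu !andbT; lia.
  by lia.
pose Ps w := (u < w)%N && (ht z w == -1).
have exs : exists w, Ps w.
  have [|||w [uw ws hw]] := @ht_cross_up z (-1) u s; try lia.
  exists w; rewrite /Ps hw eqxx andbT ltn_neqAle uw andbT.
  by apply/eqP => E; rewrite -E in hw; lia.
have [t /andP[ut /eqP hht] tmin] := ex_minnP exs.
have ts : (t <= s)%N.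
  have [|||w [uw ws hw]] := @ht_cross_up z (-1) u s; try lia.
  apply: leq_trans ws; apply: tmin; rewrite /Ps hw eqxx andbT ltn_neqAle uw andbT.
  by apply/eqP => E; rewrite -E in hw; lia.
have belowt w : (v < w < t)%N -> ht z w < -1.
  move=> /andP[vw wt]; have [wu|uw] := leqP w u; first by apply: belowu; rewrite vw.
  rewrite ltNge; apply/negP => hw.
  have [|||x [ux xw hx]] := @ht_cross_up z (-1) u w; try lia.
  have := tmin x; rewrite /Ps hx eqxx andbT ltn_neqAle ux andbT.
  have -> : (u != x) by apply/eqP => E; rewrite -E in hx; lia.
  by move/(_ isT); lia.
have rel w : ht z (v + w) = -1 + ht (iter v tau z) w by rewrite htD hv.
exists v; split=> //.
  split=> // w /andP[w0 wv]; suff: - m.+1%:Z <= ht z w < 0 by lia.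
  by apply: bs; lia.
apply: (@excursion_deep m _ (t - v) (u - v)) => //.
- have vnu : v != u by apply/eqP => E; rewrite E in hv; lia.
  split=> [||w /andP[w0 wt]]; first by lia.
    by have := rel (t - v)%N; rewrite subnKC ?hht; [lia|lia].
  have := rel w; have := belowt (v + w)%N; have := bs (v + w)%N; lia.
- by lia.
- by have := rel (u - v)%N; rewrite subnKC // hu; lia.
Qed.

(** If the descents had different lengths, the start of the shorter would lie on the longer one, at
    relative height [-1 - (-1) = 0]. *)
Lemma child_inj z z' v v' : (0 < v)%N -> (0 < v')%N ->
  is_child z v -> is_child z' v' -> iter v tau z = iter v' tau z' -> z = z'.
Proof.
wlog le : z z' v v' / (v <= v')%N => [IH v0 v0' c c' E|].
  have [le|lt] := leqP v v'; first exact: (IH z z' v v').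
  by apply/esym/(IH z' z v' v) => //; apply: ltnW.
move=> v0 v0' [hv _] [hv' bv'] E.
have {}E : z = iter (v' - v) tau z'.
  by apply: (@iter_tau_inj v); rewrite -iterD subnKC.
have [eq|ne] := eqVneq v v'; first by rewrite E eq subnn.
have := htD z' (v' - v) v; rewrite subnK // hv' -E hv => h.
by have := bv' (v' - v)%N; lia.
Qed.

(* [max_u (- ht z u)], which is nonnegative because of [u = 0]. *)
Definition drop_ht z : nat := \max_(u < r) absz (Num.min 0 (ht z u))%R.

Lemma drop_htP z u : - ht z u <= (drop_ht z)%:Z.
Proof.
have r0 := r_gt0 z.
rewrite ht_mod; have := ltn_pmod u r0; set w := (u %% r)%N => wr.
have : (absz (Num.min 0 (ht z w))%R <= drop_ht z)%N.
  exact: (@leq_bigmax _ (fun u : 'I_r => absz (Num.min 0 (ht z u))%R) (Ordinal wr)).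
by lia.
Qed.

Lemma drop_ht_ex z : exists u, - ht z u = (drop_ht z)%:Z.
Proof.
have r0 := r_gt0 z.
have [|u uE] := @bigop.eq_bigmax 'I_r (fun u => absz (Num.min 0 (ht z u))%R).
  by rewrite card_ord.
rewrite /drop_ht uE; have [le|lt] := lerP 0 (ht z u).
  by exists 0%N; rewrite ht0; lia.
by exists u; lia.
Qed.

Lemma drop_ht_le z (d : nat) : (forall u, - ht z u <= d%:Z) -> (drop_ht z <= d)%N.
Proof. by have [u uE] := drop_ht_ex z => /(_ u); rewrite uE lez_nat. Qed.

(** Heights are periodic, so a step only shifts the reference level of the maximum. Thus [drop_ht]
    is a potential with increments [eps]. *)
Lemma drop_ht_tau z : (drop_ht (tau z))%:Z = (drop_ht z)%:Z + eps z.
Proof.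
have r0 := r_gt0 z.
apply/eqP; rewrite eq_le; apply/andP; split.
  have [u uE] := drop_ht_ex (tau z); have := drop_htP z u.+1.
  by rewrite htSl; lia.
(* By periodicity, [r.-1] more steps bring [tau z] back to [z]. *)
have [u uE] := drop_ht_ex z; have := drop_htP (tau z) (r.-1 + u)%N.
by have := htSl z (r.-1 + u); rewrite -addSn prednK // htDr; lia.
Qed.

Lemma drop_ht_refl i : drop_ht (i, i) = 0%N.
Proof.
apply/eqP; rewrite -leqn0; apply: drop_ht_le => u.
by rewrite /ht big1 // => w _; rewrite iter_tau /eps subrr.
Qed.

Lemma ht_trans i j l u : ht (i, l) u = ht (i, j) u + ht (j, l) u.
Proof.
rewrite /ht -big_split; apply: eq_bigr => w _; rewrite !iter_tau /eps /=.
by ring.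
Qed.

Lemma drop_ht_trans i j l : (drop_ht (i, l) <= drop_ht (i, j) + drop_ht (j, l))%N.
Proof.
apply: drop_ht_le => u; rewrite (ht_trans i j).
by have := drop_htP (i, j) u; have := drop_htP (j, l) u; lia.
Qed.

(** The heights of [(i, pi i)] telescope to differences of two values of [e]. *)
Lemma drop_ht_succ i : (drop_ht (i, pi i) <= 1)%N.
Proof.
apply: drop_ht_le => u; suff ->: ht (i, pi i) u = (e (iter u pi i))%:Z - (e i)%:Z.
  by have := e_le1 i; lia.
elim: u => [|u IHu]; first by rewrite ht0 subrr.
by rewrite htS IHu iter_tau /eps /= -iterSr; ring.
Qed.

Definition orbit_drop z : nat := \max_(v < r) drop_ht (iter v tau z).

Lemma orbit_dropP z v : (drop_ht (iter v tau z) <= orbit_drop z)%N.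
Proof.
have r0 := r_gt0 z.
rewrite (divn_eq v r) addnC iterD iter_tau_mul.
exact: (@leq_bigmax _ (fun v : 'I_r => drop_ht (iter v tau z)) (Ordinal (ltn_pmod v r0))).
Qed.

Lemma orbit_drop_le z d : (forall v, drop_ht (iter v tau z) <= d)%N ->
  (orbit_drop z <= d)%N.
Proof. by move=> le; apply/bigmax_leqP. Qed.

Definition max_drop : nat := \max_z drop_ht z.

Lemma max_dropP z : (drop_ht z <= max_drop)%N.
Proof. exact: leq_bigmax. Qed.

Lemma max_drop_ex : (0 < max_drop)%N -> exists z, drop_ht z = max_drop.
Proof.
move=> m0; have [z _|T0] := pickP (@predT T).
  have [|z' zE] := @bigop.eq_bigmax T drop_ht; last by exists z'.
  by apply/card_gt0P; exists z.
by move: m0; rewrite /max_drop big_pred0.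
Qed.

(* Replacing [j] by [pi j] changes the drops along the orbit of [(i, j)] by at
   most 1, so all the values up to [max_drop] are attained. *)
Lemma orbit_drop_ivt m : (0 < m <= max_drop)%N -> exists z, orbit_drop z = m.
Proof.
move=> /andP[m0 le]; have [|[i j] zE] := max_drop_ex; first exact: leq_trans le.
have /porbitP[D jE] := pi_cycle i j.
pose R D := orbit_drop (i, iter D pi i).
have R0 : R 0%N = 0%N.
  apply/eqP; rewrite -leqn0; apply: orbit_drop_le => v.
  by rewrite iter_tau drop_ht_refl.
have RS d : (R d.+1 <= (R d).+1)%N.
  apply: orbit_drop_le => v; rewrite iter_tau iterS -iterS iterSr -iterSr iterS.
  have -> : iter v pi (pi (iter d pi i)) = pi (iter v pi (iter d pi i)).
    by rewrite -iterSr iterS.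
  apply: leq_trans (drop_ht_trans _ (iter v pi (iter d pi i)) _) _.
  by rewrite -iter_tau -addn1 leq_add ?orbit_dropP ?drop_ht_succ.
have RD : (m <= R D)%N.
  apply: leq_trans le _; rewrite -zE jE permX.
  exact: (orbit_dropP (i, iter D pi i) 0).
elim: D RD {jE} => [|D IHD] RD; first by move: RD; rewrite R0; lia.
have [/IHD//|lt] := leqP m (R D).
by exists (i, iter D.+1 pi i); have := RS D; rewrite -/(R D.+1); lia.
Qed.

(** A shortest descent by [m] along the orbit cannot come back to its initial height or above, since
    what remains would be a shorter descent. Prolonged to its first return to 0, it is an
    excursion. *)
Lemma deepest_pair m z : (0 < m)%N -> orbit_drop z = m ->
  exists2 a, a \in deep_pairs m & forall v, (drop_ht (iter v tau a) <= m)%N.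
Proof.
have r0 := r_gt0 z.
move=> m0 zm; pose P u := `[< exists v, ht (iter v tau z) u = - m%:Z >].
have exu : exists u, P u.
  have [|v vE] := @bigop.eq_bigmax 'I_r (fun v => drop_ht (iter v tau z)).
    by rewrite card_ord.
  have [u uE] := drop_ht_ex (iter v tau z); exists u; apply/asboolP; exists v.
  by rewrite /orbit_drop vE in zm; rewrite zm in uE; lia.
have [u /asboolP[v hu] umin] := ex_minnP exu.
set a := iter v tau z in hu.
have a_le w : (drop_ht (iter w tau a) <= m)%N.
  by rewrite -zm /a -iterD orbit_dropP.
exists a => //.
have u_neg w : (0 < w <= u)%N -> ht a w < 0.
  move=> /andP[w0 wu]; rewrite ltNge; apply/negP => hw.
  have := htD a w (u - w); rewrite subnKC // hu => h.
  have := drop_htP (iter w tau a) (u - w); have := a_le w => h1 h2.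
  have /umin : P (u - w)%N.
    by apply/asboolP; exists (w + v)%N; rewrite iterD -/a; lia.
  by lia.
have u0 : (0 < u)%N by case: (u) hu => //; rewrite ht0; lia.
pose Q s := (0 < s)%N && (ht a s == 0).
have exs : exists s, Q s by exists r; rewrite /Q r0 ht_r eqxx.
have [s /andP[s0 /eqP hs] smin] := ex_minnP exs.
have us : (u < s)%N.
  by rewrite ltnNge; apply/negP => su; have := u_neg s; rewrite s0 su hs; lia.
have neg w : (0 < w < s)%N -> ht a w < 0.
  move=> /andP[w0 ws]; rewrite ltNge; apply/negP => hw.
  have [wu|uw] := leqP w u; first by have := u_neg w; rewrite w0 wu; lia.
  have [|||x [ux xw hx]] := @ht_cross_up a 0 u w; try lia.
  by have := smin x; rewrite /Q hx eqxx (leq_trans u0 ux) => /(_ isT); lia.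
apply: (@excursion_deep m a s u) => //; split=> // [|w w_s]; first by lia.
by rewrite neg // andbT; have := drop_htP a w; have := a_le 0%N => /=; lia.
Qed.

Lemma deep_pairs_gt0 m : (0 < m <= max_drop)%N -> (0 < #|deep_pairs m|)%N.
Proof.
move=> m_le; have [z zm] := orbit_drop_ivt m_le.
have [|a a_deep _] := deepest_pair _ zm; first by case/andP: m_le.
by apply/card_gt0P; exists a.
Qed.

(** Passing to the nested excursion is injective and misses a deepest pair of an orbit without drops
    beyond [m]. *)
Lemma deep_pairs_decr m : (0 < m <= max_drop)%N ->
  (#|deep_pairs m.+1| < #|deep_pairs m|)%N.
Proof.
move=> m_le; have [z zm] := orbit_drop_ivt m_le.
have m0 : (0 < m)%N by case/andP: m_le.
have [a a_deep a_le] := deepest_pair m0 zm.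
have exc (y : T) : exists v, y \in deep_pairs m.+1 ->
    [/\ (0 < v)%N, is_child y v & iter v tau y \in deep_pairs m].
  have [/(deep_child m0)[v vP]|_] := boolP (y \in deep_pairs m.+1).
    by exists v.
  by exists 0%N.
have [c cP] := choice exc; pose f y := iter (c y) tau y.
have f_inj : {in deep_pairs m.+1 &, injective f}.
  by move=> y y' /cP[c0 cy _] /cP[c0' cy' _]; apply: child_inj.
rewrite -(card_in_imset f_inj); apply: proper_card; apply/properP; split.
  by apply/fintype.subsetP => _ /imsetP[y /cP[_ _ fy] ->].
exists a => //; apply/imsetP => -[y y_deep aE].
(* A preimage [y] would lie on the orbit of [a] and have a drop of [m.+1]. *)
have [v vE] := iter_tauK (c y) y; have := a_le v; rewrite aE vE.
have [s [u [_ _ hu _]]] := deep_excursion y_deep.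
by have := drop_htP y u; lia.
Qed.

Lemma free_pairs_mono m : free_pairs m \subset free_pairs m.+1.
Proof.
apply/fintype.subsetP => z /free_pairsP[s [s1 hs bs]]; apply/free_pairsP.
by exists s; split=> // u /bs; lia.
Qed.

Lemma free_pairs0 : free_pairs 0 = finset.set0.
Proof.
apply/setP => z; rewrite [RHS]inE; apply/free_pairsP => -[s [s1 _ bs]].
by have := bs 1%N; rewrite s1 => /(_ isT); lia.
Qed.

Lemma card_deep_pairs m : (0 < m)%N ->
  #|free_pairs m| = (#|free_pairs m.-1| + #|deep_pairs m|)%N.
Proof.
case: m => // m _; rewrite /deep_pairs /= cardsDS ?free_pairs_mono //.
by rewrite subnKC // subset_leq_card // free_pairs_mono.
Qed.

End Heights.

(** * Matrices of endomorphisms *)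

Section BasisMatrices.
Context (R : comNzRingType) (V : vectType R).
Local Notation r := (dim V).
Context (v : 'I_r -> V).

Definition basis_mx : 'M[R]_r := \matrix_i v2r (v i).

Lemma v2r_lin (c : 'rV[R]_r) : v2r (\sum_i c 0 i *: v i) = c *m basis_mx.
Proof.
rewrite linear_sum; apply/rowP => j; rewrite summxE !mxE.
by apply: eq_bigr => i _; rewrite linearZ !mxE.
Qed.

Lemma basis_mx_unit : (forall x, exists c : 'I_r -> R, x = \sum_i c i *: v i) ->
  exists Q : 'M[R]_r, Q *m basis_mx = 1%:M /\ basis_mx *m Q = 1%:M.
Proof.
move=> span; have [c cP] := choice (fun i : 'I_r => span (r2v (delta_mx 0 i))).
exists (\matrix_(i, j) c i j); suff QP : \matrix_(i, j) c i j *m basis_mx = 1%:M.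
  by split=> //; apply: mulmx1C.
apply/row_matrixP => i; rewrite row_mul row1 -[RHS]r2vK cP.
rewrite -v2r_lin; congr v2r; apply: eq_bigr => j _.
by rewrite !mxE.
Qed.

Context (Q : 'M[R]_r) (QP : Q *m basis_mx = 1%:M) (PQ : basis_mx *m Q = 1%:M).

Definition coords (x : V) : 'rV[R]_r := v2r x *m Q.

Lemma coordsK x : \sum_i coords x 0 i *: v i = x.
Proof. by apply: v2r_inj; rewrite v2r_lin /coords -mulmxA QP mulmx1. Qed.

Lemma coords_lin (c : 'I_r -> R) : coords (\sum_i c i *: v i) = \row_i c i.
Proof.
rewrite /coords (eq_bigr (fun i => (\row_i c i) 0 i *: v i)) => [|i _].
  by rewrite v2r_lin -mulmxA PQ mulmx1.
by rewrite mxE.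
Qed.

Lemma coords_inj (c d : 'I_r -> R) :
  \sum_i c i *: v i = \sum_i d i *: v i -> c =1 d.
Proof.
move/(congr1 coords); rewrite !coords_lin => /rowP cd i.
by have := cd i; rewrite !mxE.
Qed.

(** Matrices act on row vectors from the right, so composites appear in reversed order in
    [mx_endM]. *)
Definition mx_end (A : 'M[R]_r) (x : V) : V := r2v (v2r x *m (Q *m A *m basis_mx)).

Fact mx_end_linear A : linear (mx_end A).
Proof. by move=> a x y; rewrite /mx_end !linearP mulmxDl -scalemxAl linearP. Qed.
HB.instance Definition _ A := GRing.isLinear.Build R V V _ (mx_end A) (mx_end_linear A).

Lemma v2r_basis i : v2r (v i) = row i basis_mx.
Proof. by apply/rowP => j; rewrite !mxE. Qed.

Lemma mx_end_basis A i : mx_end A (v i) = \sum_j A i j *: v j.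
Proof.
apply: v2r_inj; rewrite /mx_end r2vK (eq_bigr (fun j => (row i A) 0 j *: v j)).
  rewrite v2r_lin v2r_basis -row_mul !mulmxA PQ mul1mx.
  by rewrite row_mul.
by move=> j _; rewrite !mxE.
Qed.

Lemma mx_endM A B x : mx_end B (mx_end A x) = mx_end (A *m B) x.
Proof.
rewrite /mx_end r2vK -!mulmxA; congr (r2v (_ *m (_ *m (_ *m _)))).
by rewrite !mulmxA PQ mul1mx.
Qed.

Lemma mx_end1 x : mx_end 1%:M x = x.
Proof. by rewrite /mx_end mulmx1 QP mulmx1 v2rK. Qed.

Lemma mx_end_bij A B : A *m B = 1%:M -> bijective (mx_end A).
Proof.
move=> AB; have BA := mulmx1C AB.
by exists (mx_end B) => x; rewrite mx_endM ?AB ?BA mx_end1.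
Qed.

Section Endomorphism.
Context (f : {linear V -> V}).

Definition std_mx : 'M[R]_r := \matrix_(i, j) v2r (f (r2v (delta_mx 0 i))) 0 j.

Lemma std_mxE x : v2r (f x) = v2r x *m std_mx.
Proof.
have xE : x = \sum_i (v2r x) 0 i *: r2v (delta_mx 0 i).
  rewrite -{1}(v2rK x) {1}(row_sum_delta (v2r x)) linear_sum.
  by apply: eq_bigr => i _; rewrite linearZ.
rewrite {1}xE !linear_sum; apply/rowP => j; rewrite summxE mxE.
by apply: eq_bigr => i _; rewrite !linearZ !mxE.
Qed.

Definition end_to_mx : 'M[R]_r := basis_mx *m std_mx *m Q.

Lemma std_mx_basis : std_mx = Q *m end_to_mx *m basis_mx.
Proof. by rewrite /end_to_mx -!mulmxA QP mulmx1 mulmxA QP mul1mx. Qed.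

Lemma end_to_mxK x : mx_end end_to_mx x = f x.
Proof. by apply: v2r_inj; rewrite /mx_end r2vK -std_mx_basis std_mxE. Qed.

Lemma end_to_mx_bij : bijective f -> exists B, end_to_mx *m B = 1%:M.
Proof.
move=> [g fK gK].
pose B := \matrix_(i, j) coords (g (v i)) 0 j; exists B; apply: mulmx1C.
apply/row_matrixP => i; rewrite row_mul row1.
have: f (g (v i)) = v i by [].
rewrite -{1}(coordsK (g (v i))) -end_to_mxK => /(congr1 coords).
rewrite linear_sum (eq_bigr (fun j => \sum_l (B i j * end_to_mx j l) *: v l)).
  rewrite exchange_big /= => E; apply/rowP => l.
  have := congr1 (fun c : 'rV_r => c 0 l) E.
  rewrite (eq_bigr (fun l => (\sum_j B i j * end_to_mx j l) *: v l)) => [|j _].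
    rewrite coords_lin /coords v2r_basis -row_mul PQ row1 !mxE => <-.
    by apply: eq_bigr => j _; rewrite !mxE.
  by rewrite scaler_suml.
move=> j _; rewrite linearZ /= mx_end_basis scaler_sumr.
by apply: eq_bigr => l _; rewrite scalerA [B i j]mxE.
Qed.

End Endomorphism.

Lemma mx_endK A : end_to_mx (mx_end A) = A.
Proof.
apply/matrixP => i; have: mx_end (end_to_mx (mx_end A)) (v i) = mx_end A (v i).
  by rewrite (end_to_mxK (mx_end A)).
by rewrite !mx_end_basis => /coords_inj.
Qed.

End BasisMatrices.

(** * Lang's theorem *)

Lemma sum_cyclic (F : nat -> nat) n : F n = F 0%N ->
  (\sum_(u < n) F u.+1 = \sum_(u < n) F u)%N.
Proof.
case: n => [|n] Fn; first by rewrite !big_ord0.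
by rewrite big_ord_recr big_ord_recl /= Fn addnC.
Qed.

Section WittMatrices.
Context (k : closedFieldType) (p : nat) (pchark : p \in [pchar k]).
Local Notation W := (witt pchark).
Local Notation sigma := (@wfrob k p pchark).
Local Notation wred := (@wred k p pchark).
Implicit Types x y : W.

Lemma wcongD n x x' y y' : wcong n x x' -> wcong n y y' -> wcong n (x + y) (x' + y').
Proof.
move=> /wcongP[a ->] /wcongP[b ->]; apply/wcongP; exists (a + b).
by rewrite mulrDr addrACA.
Qed.

Lemma wcongM n x x' y y' : wcong n x x' -> wcong n y y' -> wcong n (x * y) (x' * y').
Proof.
move=> /wcongP[a ->] /wcongP[b ->]; apply/wcongP.
by exists (a * y' + x' * b + p%:R ^+ n * a * b); ring.
Qed.

Lemma wcong_sum n (I : Type) (s : seq I) (P : pred I) (F G : I -> W) :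
  (forall i, wcong n (F i) (G i)) ->
  wcong n (\sum_(i <- s | P i) F i) (\sum_(i <- s | P i) G i).
Proof. by move=> FG; elim/big_rec2: _ => // i x y _; apply: wcongD. Qed.

Lemma wcong_sigma n x y : wcong n x y -> wcong n (sigma x) (sigma y).
Proof. by move=> xy l /xy /= ->. Qed.

Lemma wcong_sym n x y : wcong n x y -> wcong n y x.
Proof. by move=> xy l /xy. Qed.

Lemma wcong_trans n x y z : wcong n x y -> wcong n y z -> wcong n x z.
Proof. by move=> xy yz l lt; rewrite xy // yz. Qed.

Lemma wcong_eq x y : (forall n, wcong n x y) -> x = y.
Proof. by move=> xy; apply/witt_coefP => n; apply: (xy n.+1). Qed.

Lemma wred_p x n : (0 < n)%N -> wred (p%:R ^+ n * x) = 0.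
Proof. by move=> n0; rewrite /wred wmulpX_coef n0. Qed.

(** [W] is local: a determinant with nonzero residue is a unit, and the adjugate gives an
    inverse. *)
Lemma mx_unit_red r (A : 'M[W]_r) :
  \det (map_mx wred A) != 0 <-> exists B, A *m B = 1%:M.
Proof.
split=> [|[B AB]]; last first.
  apply/eqP => dA0; have := congr1 (fun A => \det (map_mx wred A)) AB.
  by rewrite map_mxM det_mulmx dA0 mul0r map_mx1 det1 => /esym/eqP; rewrite oner_eq0.
rewrite det_map_mx => /witt_unit[y yA]; exists (y *: \adj A).
by rewrite -scalemxAr mul_mx_adj scale_scalar_mx yA.
Qed.

Section Lang.
Context (r : nat) (pi : 'S_r) (e : 'I_r -> nat).
Hypothesis e_le1 : forall i, (e i <= 1)%N.
Hypothesis pi_cycle : forall i j, j \in porbit pi i.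
Local Notation T := ('I_r * 'I_r)%type.
Local Notation tau := (pair_map pi).
Local Notation h := (drop_ht pi e).

Definition weight (z : T) : nat := \sum_(u < r) h (iter u tau z).

Lemma weight_tau z : weight (tau z) = weight z.
Proof.
rewrite /weight (eq_bigr (fun u : 'I_r => h (iter u.+1 tau z))) => [|u _].
  by apply: (@sum_cyclic (fun u => h (iter u tau z))); rewrite iter_tau_r.
by rewrite -iterSr.
Qed.

Lemma weight_ge z : (h z <= weight z)%N.
Proof. by rewrite /weight (bigD1 (Ordinal (r_gt0 z))) //= leq_addr. Qed.

(* [weight] is [r] times the mean of [h] on the orbit, so [r v_p(Y z) + weight z]
   is, up to the scaling by [p ^ h], a submultiplicative valuation on matrices
   that is constant along orbits. *)
Definition defect i j l := (h (i, j) + h (j, l) - h (i, l))%N.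

(** [drop_ht] changes by [eps] along [tau] and [eps] is additive in composable pairs, so the defect
    is constant on orbits and sums to [r] times its value. *)
Lemma weight_defect i j l :
  (r * defect i j l + weight (i, l) = weight (i, j) + weight (j, l))%N.
Proof.
have d_tau u : defect (iter u pi i) (iter u pi j) (iter u pi l) = defect i j l.
  elim: u => // u <-; rewrite !iterS /defect.
  set a := iter u pi i; set b := iter u pi j; set c := iter u pi l.
  have := drop_ht_tau e pi_cycle (a, b).
  have := drop_ht_tau e pi_cycle (b, c).
  have := drop_ht_tau e pi_cycle (a, c).
  by rewrite /pair_map /slope_diff /=; lia.
rewrite /weight -big_split /= -[X in (X * _)%N]card_ord -sum_nat_const -big_split.
apply: eq_bigr => u _ /=; rewrite !iter_tau -(d_tau u) /defect subnK //.
exact: drop_ht_trans.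
Qed.

(** The ceiling of [(s - weight z) / r]: the power of [p] needed at the entry [z] for valuation at
    least [s]. *)
Definition cdepth (s : nat) (z : T) : nat := ((s - weight z) + r.-1) %/ r.

Lemma cdepth_tau s z : cdepth s (tau z) = cdepth s z.
Proof. by rewrite /cdepth weight_tau. Qed.

Lemma cdepthP s z : (s <= r * cdepth s z + weight z)%N.
Proof.
rewrite /cdepth; have r0 := r_gt0 z; have := ltn_pmod (s - weight z + r.-1) r0.
by have := divn_eq (s - weight z + r.-1) r; set q := (_ %/ r)%N; nia.
Qed.

Lemma cdepth_le s c z : (s <= r * c + weight z)%N -> (cdepth s z <= c)%N.
Proof.
move=> le; rewrite /cdepth -ltnS ltn_divLR ?(r_gt0 z) //.
by have := r_gt0 z; nia.
Qed.

Definition deep s (Y : T -> W) := forall z, exists y, Y z = p%:R ^+ cdepth s z * y.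

Lemma deepP s Y :
  (forall z, exists c y, (s <= r * c + weight z)%N /\ Y z = p%:R ^+ c * y) ->
  deep s Y.
Proof.
move=> Yc z; have [c [y [/cdepth_le le ->]]] := Yc z.
by exists (p%:R ^+ (c - cdepth s z) * y); rewrite mulrA -exprD subnKC.
Qed.

Lemma deep_le s t Y : (s <= t)%N -> deep t Y -> deep s Y.
Proof.
move=> le dY; apply: deepP => z; have [y ->] := dY z.
by exists (cdepth t z), y; split=> //; apply: leq_trans le (cdepthP _ _).
Qed.

(* [Phi - 1] is a factor of [Phi ^ r - 1], which acts on each entry separately
   and is onto by Artin-Schreier. *)
Lemma frobenius_sub_surj (C : T -> W) :
  exists Y, forall z, sigma (Y z) = Y (tau z) + C (tau z).
Proof.
have ex (z : T) := witt_artin_schreier (C z) (r_gt0 z).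
have [Y' Y'P] := choice ex.
(* [F u] is [Phi ^ u] applied to [Y']: [u * r.-1] steps of [tau] amount to [u] steps backwards. *)
pose F u z := iter u sigma (Y' (iter (u * r.-1) tau z)).
have FS u z : sigma (F u z) = F u.+1 (tau z).
  rewrite /F iterS mulSn addnC iterD -iterSr; congr (sigma (iter _ _ (Y' _))).
  by rewrite prednK ?(r_gt0 z) // iter_tau_r.
exists (fun z => \sum_(u < r) F u z) => z; rewrite rmorph_sum.
rewrite (eq_bigr (fun u : 'I_r => F u.+1 (tau z))) => [|u _]; last exact: FS.
have tel : \sum_(u < r) (F u.+1 (tau z) - F u (tau z)) = C (tau z).
  rewrite -(big_mkord predT (fun u => F u.+1 (tau z) - F u (tau z))).
  rewrite telescope_sumr // /F /= mulnC iter_tau_mul // Y'P.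
  by rewrite addrC addKr.
by rewrite -tel sumrB addrC subrK.
Qed.

(** The required powers of [p] are constant on orbits and fixed by Frobenius, so they factor out of
    the equation. *)
Lemma frobenius_sub_surj_deep s (C : T -> W) : deep s C ->
  exists2 Y, deep s Y & forall z, sigma (Y z) = Y (tau z) + C (tau z).
Proof.
move=> dC; have [C' C'E] := choice dC; have [Y YE] := frobenius_sub_surj C'.
exists (fun z => p%:R ^+ cdepth s z * Y z) => [z|z]; first by exists (Y z).
by rewrite rmorphM rmorphXn rmorph_nat /= YE C'E cdepth_tau mulrDr.
Qed.

(** The matrix product, written in the coordinates [Y] of matrices [p ^ h(z) * Y z]. *)
Definition star (U Y : T -> W) (z : T) : W :=
  \sum_j p%:R ^+ defect z.1 j z.2 * (U (z.1, j) * Y (j, z.2)).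

Lemma starD U Y Z z : star U (fun z => Y z + Z z) z = star U Y z + star U Z z.
Proof. by rewrite /star -big_split; apply: eq_bigr => j _; rewrite /= !mulrDr. Qed.

Lemma star0 U z : star U (fun=> 0) z = 0.
Proof. by rewrite /star big1 // => j _; rewrite !mulr0. Qed.

Lemma deep_sum s (I : finType) (Y : I -> T -> W) : (forall i, deep s (Y i)) ->
  deep s (fun z => \sum_i Y i z).
Proof.
move=> dY z; have [y yE] := choice (fun i => dY i z).
by exists (\sum_i y i); rewrite mulr_sumr; apply: eq_bigr => i _.
Qed.

Lemma star_deep s t U Y : deep s U -> deep t Y -> deep (s + t) (star U Y).
Proof.
move=> dU dY; apply: deep_sum => j; apply: deepP => -[i l] /=.
have [[a ->] [b ->]] := (dU (i, j), dY (j, l)).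
exists (defect i j l + cdepth s (i, j) + cdepth t (j, l))%N, (a * b).
split; last by rewrite !exprD; ring.
rewrite !mulnDr; have := weight_defect i j l.
have := cdepthP s (i, j); have := cdepthP t (j, l).
set A1 := (r * cdepth t _)%N; set A2 := (r * cdepth s _)%N.
set A3 := (r * defect _ _ _)%N; set B1 := weight _; set B2 := weight _.
by set B3 := weight _; lia.
Qed.

Definition max_weight : nat := \max_z weight z.

Lemma deep_dvd s n Y : (r * n + max_weight <= s)%N -> deep s Y ->
  forall z, exists y, Y z = p%:R ^+ n * y.
Proof.
move=> le dY z; have [y ->] := dY z.
have wz : (weight z <= max_weight)%N by apply: leq_bigmax.
have len : (n <= cdepth s z)%N.
  by have := cdepthP s z; have := r_gt0 z; nia.
by exists (p%:R ^+ (cdepth s z - n) * y); rewrite mulrA -exprD subnKC.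
Qed.

(** [Y] is a series: each new term solves the additive equation with [star U] of the previous term
    on the right, which raises its valuation by 1. *)
Lemma frobenius_fixpoint U : deep 1 U ->
  exists2 Y, deep 1 Y &
    forall z, sigma (Y z) = Y (tau z) + U (tau z) + star U Y (tau z).
Proof.
move=> dU; have [X0 dX0 X0E] := frobenius_sub_surj_deep dU.
have step (sX : nat * (T -> W)) : exists X' : T -> W, deep sX.1 sX.2 ->
    deep sX.1.+1 X' /\ forall z, sigma (X' z) = X' (tau z) + star U sX.2 (tau z).
  have [dX|] := pselect (deep sX.1 sX.2); last by exists sX.2.
  have [X' dX' X'E] := frobenius_sub_surj_deep (star_deep dU dX).
  by exists X'.
have [S SP] := choice step.
pose fix X n := if n is n'.+1 then S (n, X n') else X0.
have dX n : deep n.+1 (X n) by elim: n => // n /(SP (_, _))[].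
have XE n z : sigma (X n.+1 z) = X n.+1 (tau z) + star U (X n) (tau z).
  by have [_] := SP (n.+1, X n) (dX n); apply.
pose Ys n z := \sum_(s < n) X s z.
have Ys0 : Ys 0%N = fun=> 0 by apply/funext => z; rewrite /Ys big_ord0.
have YsS n : Ys n.+1 = fun z => Ys n z + X n z.
  by apply/funext => z; rewrite /Ys big_ord_recr.
have YsE n z : sigma (Ys n.+1 z) = Ys n.+1 (tau z) + U (tau z) + star U (Ys n) (tau z).
  elim: n => [|n IHn]; first by rewrite YsS Ys0 star0 !add0r addr0 X0E.
  rewrite (_ : star U (Ys n.+1) _ = star U (Ys n) (tau z) + star U (X n) (tau z)).
    rewrite (YsS n.+1); apply: etrans (rmorphD sigma _ _) _.
    rewrite [X in X + _]IHn [X in _ + X]XE; ring.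
  by rewrite -starD YsS.
(* From this index on, every further term is divisible by [p ^ n]. *)
pose N n := (r * n + max_weight)%N.
have Ys_cong n a z : (N n <= a)%N -> wcong n (Ys a z) (Ys (N n) z).
  move=> le; rewrite -(subnKC le); elim: (a - N n)%N => [|d IHd]; first by rewrite addn0.
  rewrite addnS; apply: wcong_trans IHd; rewrite /Ys big_ord_recr /=.
  have [|y ->] := @deep_dvd _ n _ _ (dX (N n + d)%N) z.
    by rewrite -/(N n) -addnS leq_addr.
  by apply/wcongP; exists y.
have lim z : exists y, forall n, wcong n y (Ys (N n) z).
  apply: (@witt_complete _ _ _ (fun n => Ys (N n) z)) => n.
  by apply: Ys_cong; rewrite /N; have := r_gt0 z; nia.
have [Y YP] := choice lim.
have YsY n a z : (N n <= a)%N -> wcong n (Y z) (Ys a z).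
  move=> le; apply: wcong_trans (YP z n) _; apply: wcong_sym; exact: Ys_cong.
have dYs n : deep 1 (Ys n) by apply: deep_sum => i; apply: deep_le (dX i).
exists Y => [z|z].
  have [y yE] := dYs (N (cdepth 1 z)) z.
  have /wcongP[y' ->] := YP z (cdepth 1 z).
  by exists (y + y'); rewrite yE mulrDr.
apply: wcong_eq => n; apply: wcong_trans (wcong_sigma (YsY n (N n).+1 z _)) _.
  exact: leqnSn.
rewrite YsE; apply: wcong_sym; apply: wcongD; first apply: wcongD => //.
  exact: YsY (leqnSn _).
by apply: wcong_sum => j; do 2!apply: wcongM => //; apply: YsY.
Qed.

Definition twisted_mx (Y : T -> W) : 'M[W]_r :=
  \matrix_(i, j) (p%:R ^+ h (i, j) * Y (i, j)).

Lemma twisted_mxM U Y : twisted_mx U *m twisted_mx Y = twisted_mx (star U Y).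
Proof.
apply/matrixP => i l; rewrite !mxE mulr_sumr; apply: eq_bigr => j _.
rewrite !mxE /=; have le : (h (i, l) <= h (i, j) + h (j, l))%N by exact: drop_ht_trans.
rewrite mulrACA -exprD -(subnKC le) exprD -/(defect i j l); ring.
Qed.

Lemma twisted_mx_nilp Y : deep 1 Y ->
  exists n B, twisted_mx Y ^+ n = p%:R *: B.
Proof.
move=> dY; have pow n : exists2 Z, deep n.+1 Z & twisted_mx Y ^+ n.+1 = twisted_mx Z.
  elim: n => [|n [Z dZ E]]; first by exists Y; rewrite ?expr1.
  by exists (star Y Z); [exact: (star_deep dY dZ)|rewrite exprS E -twisted_mxM].
have [Z dZ E] := pow (r * 1 + max_weight)%N.
have [y yE] := choice (deep_dvd (leqnSn _) dZ).
exists (r * 1 + max_weight).+1, (twisted_mx y); rewrite E.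
by apply/matrixP => i j; rewrite !mxE yE expr1 mulrCA.
Qed.

(** Modulo [p] the matrix [twisted_mx Y] is nilpotent, so a finite geometric series inverts
    [1 + twisted_mx Y]. *)
Lemma twisted_mx_unit Y : deep 1 Y -> exists B, (1%:M + twisted_mx Y) *m B = 1%:M.
Proof.
move=> /twisted_mx_nilp[n [B E]]; apply/mx_unit_red.
set N := twisted_mx Y in E *.
have FS : (1%:M + N) *m (\sum_(i < n) (- N) ^+ i) = 1%:M - (- N) ^+ n.
  have := subrX1 (- N) n; rewrite -[1%:M]/(1 : 'M_r) -[_ *m _]/(_ * _).
  by move=> /(congr1 -%R); rewrite opprB => ->; rewrite -mulNr opprB opprK.
have := congr1 (fun A => \det (map_mx wred A)) FS.
rewrite map_mxM det_mulmx exprNn E map_mxB map_mx1.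
rewrite (_ : map_mx wred (_ * _) = 0) ?subr0 ?det1 => [dFS|].
  by apply/eqP => d0; move: dFS; rewrite d0 mul0r => /esym/eqP; rewrite oner_eq0.
rewrite -[_ * _]/(_ *m _) -scalemxAr; move: (_ *m _) => C.
by apply/matrixP => i j; rewrite !mxE -[p%:R]expr1 wred_p.
Qed.

Lemma lang_mx (H : 'M[W]_r) : let n := max_drop pi e in (0 < n)%N ->
  exists2 F, (exists B, F *m B = 1%:M) &
    forall i j, p%:R ^+ e i * ((1%:M + p%:R ^+ n *: H) *m F) (pi i) (pi j) =
                p%:R ^+ e j * sigma (F i j).
Proof.
move=> n n0; pose U z := p%:R ^+ (n - h z) * H z.1 z.2.
have UE : p%:R ^+ n *: H = twisted_mx U.
  by apply/matrixP => i j; rewrite !mxE mulrA -exprD subnKC // max_dropP.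
(* If [h z < n], the factor [p ^ (n - h z)] suffices; if [h z = n], the weight is at least
   [n > 0]. *)
have dU : deep 1 U.
  apply: deepP => z; exists (n - h z)%N, (H z.1 z.2); split=> //.
  have : (h z <= n)%N by exact: max_dropP.
  have := weight_ge z; have := r_gt0 z.
  by nia.
have [Y dY YE] := frobenius_fixpoint dU.
exists (1%:M + twisted_mx Y); first exact: twisted_mx_unit.
move=> i j; rewrite UE mulmxDl mul1mx mulmxDr mulmx1 twisted_mxM.
have := YE (i, j); rewrite /pair_map /= => YE'.
have hE := drop_ht_tau e pi_cycle (i, j); rewrite /pair_map /slope_diff /= in hE.
rewrite !mxE rmorphD rmorphM rmorphXn !rmorph_nat /= YE' (inj_eq perm_inj).
have dE : p%:R ^+ e i * (i == j)%:R = p%:R ^+ e j * (i == j)%:R :> W.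
  by case: eqP => [->|]; rewrite ?mulr0.
have pE : p%:R ^+ e i * p%:R ^+ h (pi i, pi j) = p%:R ^+ e j * p%:R ^+ h (i, j) :> W.
  by rewrite -!exprD; congr (_ ^+ _); move: hE; set A := h _; set B := h _; lia.
rewrite !mulrDr dE !mulrA pE /=; ring.
Qed.

End Lang.
End WittMatrices.

(** * The isomorphism number *)

Section Crystals.
Context (k : closedFieldType) (p : nat) (pchark : p \in [pchar k]).
Local Notation W := (witt pchark).
Local Notation sigma := (@wfrob k p pchark).
Local Open Scope classical_set_scope.

Lemma sigma_surj (x : W) : exists y, sigma y = x.
Proof.
have [c cP] := choice (fun l => ppower_surj pchark 1 (x l)).
by exists (Witt pchark c); apply/witt_coefP => l; rewrite /= -{1}(expn1 p).
Qed.

Section Monomial.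
Context (M : fcrystal pchark) (v : 'I_(dim M) -> M) (e : 'I_(dim M) -> nat).
Context (s : 'S_(dim M)).
Local Notation phi := (fc_phi M).
Hypothesis span : forall x, exists c : 'I_(dim M) -> W, x = \sum_i c i *: v i.
Hypothesis phi_v : forall i, phi (v i) = p%:R ^+ e i *: v (s i).

Lemma phi_lin (c : 'I_(dim M) -> W) :
  phi (\sum_i c i *: v i) = \sum_i (p%:R ^+ e i * sigma (c i)) *: v (s i).
Proof.
rewrite linear_sum; apply: eq_bigr => i _.
by rewrite linearZ /= phi_v scalerA mulrC.
Qed.

Definition slope_part (b : nat) : set M :=
  [set x | exists2 c : 'I_(dim M) -> W, (forall i, e i <> b -> c i = 0) &
     x = \sum_i c i *: v i].

Lemma slope_part_submodule b : is_submodule (slope_part b).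
Proof.
split=> [|a _ _ [c c0 ->] [d d0 ->]].
  by exists (fun=> 0) => //; rewrite big1 // => i _; rewrite scale0r.
exists (fun i => a * c i + d i) => [i ib|]; first by rewrite c0 // d0 // mulr0 addr0.
rewrite scaler_sumr -big_split; apply: eq_bigr => i _ /=.
by rewrite scalerDl scalerA.
Qed.

Hypothesis e_le1 : forall i, (e i <= 1)%N.
Hypothesis e_s : forall i, e (s i) = e i.

Lemma phi_slope_part b :
  phi @` slope_part b = [set p%:R ^+ b *: x | x in slope_part b].
Proof.
have phiE c : (forall i, e i <> b -> c i = 0) ->
    phi (\sum_i c i *: v i) = p%:R ^+ b *: \sum_i sigma (c ((s^-1)%g i)) *: v i.
  move=> c0; rewrite phi_lin scaler_sumr [RHS](reindex_inj (@perm_inj _ s)) /=.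
  apply: eq_bigr => i _; rewrite permK scalerA.
  by have [->//|/eqP/c0->] := eqVneq (e i) b; rewrite rmorph0 !mulr0.
apply/seteqP; split=> _ [x [c c0 ->] <-].
  exists (\sum_i sigma (c ((s^-1)%g i)) *: v i); last by rewrite phiE.
  exists (fun i => sigma (c ((s^-1)%g i))) => // i ib.
  by rewrite c0 ?rmorph0 // -e_s permKV.
have ex i : exists y : W, (e i <> b -> y = 0) /\ sigma y = c (s i).
  have [y yE] := sigma_surj (c (s i)).
  have [eb|/eqP ne] := eqVneq (e i) b; first by exists y; split.
  by exists 0; split=> //; rewrite rmorph0 c0 ?e_s.
have [d dP] := choice ex.
exists (\sum_i d i *: v i); first by exists d => // i; case: (dP i).
rewrite phiE => [|i]; last by case: (dP i).
congr (_ *: _); apply: eq_bigr => i _.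
by have [_ ->] := dP ((s^-1)%g i); rewrite permKV.
Qed.

(** Since [e] is constant along [s], the basis vectors with [e i = 0] and with [e i = 1] span the
    two summands. *)
Lemma ordinary_monomial : is_ordinary M.
Proof.
have [Q [QP PQ]] := basis_mx_unit span.
exists (slope_part 0), (slope_part 1); split; try exact: slope_part_submodule.
- move=> x; have [c xE] := span x.
  pose c0 i := if e i == 0%N then c i else 0.
  pose c1 i := if e i == 0%N then 0 else c i.
  exists (\sum_i c0 i *: v i, \sum_i c1 i *: v i); split=> [|[u0 u1] /=].
    split=> /=.
    - by exists c0 => // i; rewrite /c0; case: eqP.
    - by exists c1 => // i; rewrite /c1; case: eqP => // ei; have := e_le1 i; lia.
    rewrite xE -big_split; apply: eq_bigr => i _ /=; rewrite /c0 /c1.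
    by case: eqP; rewrite scale0r ?addr0 ?add0r.
  move=> [/= [d0 d0P ->] [d1 d1P ->] xE2].
  have : \sum_i c i *: v i = \sum_i (d0 i + d1 i) *: v i.
    rewrite -xE xE2 -big_split; apply: eq_bigr => i _; exact/esym/scalerDl.
  move/(coords_inj PQ) => cE; congr (_, _); apply: eq_bigr => i _; congr (_ *: _).
    rewrite /c0 cE; case: eqP => ei; last by rewrite d0P.
    by rewrite d1P ?addr0 // ei.
  rewrite /c1 cE; case: eqP => ei; first by rewrite d1P ?ei.
  by rewrite d0P ?add0r.
- rewrite phi_slope_part; apply/seteqP; split=> [_ [x xM <-]|x xM].
    by rewrite scale1r.
  by exists x => //; rewrite scale1r.
by rewrite phi_slope_part.
Qed.

End Monomial.

Section Circular.
Context (M : fcrystal pchark) (v : 'I_(dim M) -> M) (e : 'I_(dim M) -> nat).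
Context (s : 'S_(dim M)).
Local Notation phi := (fc_phi M).
Hypothesis span : forall x, exists c : 'I_(dim M) -> W, x = \sum_i c i *: v i.
Hypothesis phi_v : forall i, phi (v i) = p%:R ^+ e i *: v (s i).
Hypothesis e_le1 : forall i, (e i <= 1)%N.
Hypothesis s_cycle : forall i j, j \in porbit s i.

Lemma not_iso_bound0 : ~ is_ordinary M -> ~ iso_bound M 0.
Proof.
move=> nord bound; apply: nord; have [Q [QP PQ]] := basis_mx_unit span.
(* [g] cancels the permutation: the twisted operator is diagonal in [v]. *)
pose g : {linear M -> M} := mx_end v Q (perm_mx s^-1).
have g_v i : g (v (s i)) = v i.
  rewrite /g /= (mx_end_basis PQ) (bigD1 i) //= big1 => [|j ji].
    by rewrite !mxE permK eqxx scale1r addr0.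
  by rewrite !mxE permK eq_sym (negPf ji) scale0r.
have g_bij : bijective g.
  apply: (mx_end_bij QP PQ (B := perm_mx s)).
  by rewrite -perm_mxM mulVg perm_mx1.
have [|h [[h' hK h'K] hphi]] := bound g g_bij.
  (* Every automorphism is congruent to 1 modulo [p ^ 0]. *)
  by exists (g \- idfun) => x /=; rewrite scale1r addrC subrK.
pose w i : M := h (v i).
apply: (@ordinary_monomial M w e 1%g) => // [x|i|i]; last by rewrite perm1.
  have [c cE] := span (h' x); exists c; rewrite -(h'K x) cE linear_sum.
  by apply: eq_bigr => i _; rewrite linearZ.
rewrite -hphi /= /twist_phi phi_v linearZ /= g_v linearZ perm1 //.
Qed.

(** A pair [(i, j)] without drop has [e i <= e j], so without any drops [e] is constant. *)
Lemma max_drop_gt0 : ~ is_ordinary M -> (0 < max_drop s e)%N.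
Proof.
move=> nord; rewrite lt0n; apply/eqP => m0; apply: nord.
have e_const i j : (e i <= e j)%N.
  have d0 : drop_ht s e (i, j) = 0%N.
    by apply/eqP; rewrite -leqn0 -m0; apply: max_dropP.
  by have := drop_htP e s_cycle (i, j) 1; rewrite d0 ht1 /slope_diff /=; lia.
apply: (@ordinary_monomial M v e s) => // i.
by apply/eqP; rewrite eqn_leq !e_const.
Qed.

Lemma twist_iso (Q F : 'M[W]_(dim M)) (g : {linear M -> M}) (g_bij : bijective g) :
  Q *m basis_mx v = 1%:M -> basis_mx v *m Q = 1%:M ->
  (exists B, F *m B = 1%:M) ->
  (forall i j, p%:R ^+ e i * (end_to_mx v Q g *m F) (s i) (s j) =
               p%:R ^+ e j * sigma (F i j)) ->
  fc_iso (twist (bij_inj g_bij)) M.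
Proof.
move=> QP PQ [B FB] FE; exists (mx_end v Q F : {linear M -> M}).
split=> [|x]; first exact (mx_end_bij QP PQ FB).
change (mx_end v Q F (g (phi x)) = phi (mx_end v Q F x)).
rewrite -(end_to_mxK QP g) mx_endM //; set G := end_to_mx v Q g in FE *.
have [c ->] := span x; rewrite (phi_lin phi_v) !linear_sum /=.
apply: eq_bigr => i _; rewrite !linearZ /= !mx_end_basis // (phi_lin phi_v).
rewrite (reindex_inj (@perm_inj _ s)) /= !scaler_sumr.
apply: eq_bigr => j _; rewrite !scalerA [p%:R ^+ e i * _]mulrC -mulrA FE.
by congr (_ *: _); ring.
Qed.

Lemma iso_bound_max_drop : ~ is_ordinary M -> iso_bound M (max_drop s e).
Proof.
move=> nord g g_bij [h gh]; have [Q [QP PQ]] := basis_mx_unit span.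
pose H := end_to_mx v Q h.
have GE : end_to_mx v Q g = 1%:M + p%:R ^+ max_drop s e *: H.
  rewrite /H /end_to_mx; rewrite (_ : std_mx g = 1%:M + p%:R ^+ max_drop s e *: std_mx h).
    by rewrite mulmxDr mulmx1 mulmxDl PQ -scalemxAr -scalemxAl.
  apply/matrixP => i j; rewrite !mxE gh linearD linearZ /= r2vK !mxE eqxx /=.
  by rewrite eq_sym.
have [F Funit FE] := lang_mx s_cycle H (max_drop_gt0 nord).
by apply: (twist_iso g_bij QP PQ Funit) => i j; rewrite GE FE.
Qed.

(** [max_drop] is a bound, so a least one exists and the default of [xget] does not occur. *)
Lemma isomorphism_number_bounds : ~ is_ordinary M ->
  (1 <= isomorphism_number M <= max_drop s e)%N.
Proof.
move=> nord; have bound := iso_bound_max_drop nord.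
have exn : exists n, `[< iso_bound M n >] by exists (max_drop s e); apply/asboolP.
have [n0 /asboolP bn0 n0min] := ex_minnP exn.
rewrite /isomorphism_number; case: xgetP => [n _ [bn nmin]|/(_ n0)[]].
  rewrite nmin // andbT lt0n; apply/eqP => n00.
  by apply: (not_iso_bound0 nord); rewrite -n00.
by split=> // m bm; apply: n0min; apply/asboolP.
Qed.

End Circular.
End Crystals.

(** * Conjugation by a monomial semilinear map, on matrix entries *)

Section SemilinearMonomial.
Context (R : comNzRingType) (V : vectType R) (sigma : {rmorphism R -> R}).
Context (phi : {linear V -> V | sigma \; *:%R}) (v : 'I_(dim V) -> V).
Context (s : 'S_(dim V)) (b : 'I_(dim V) -> R).
Hypothesis span : forall x, exists c : 'I_(dim V) -> R, x = \sum_i c i *: v i.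
Hypothesis phi_v : forall i, phi (v i) = b i *: v (s i).
Context (Q : 'M[R]_(dim V)).
Hypothesis QP : Q *m basis_mx v = 1%:M.
Hypothesis PQ : basis_mx v *m Q = 1%:M.

Lemma semilinear_commute_mod (a : R) (f : {linear V -> V}) :
  (exists h : {linear V -> V}, forall x, phi (f x) = f (phi x) + a *: h (phi x)) <->
  exists H : 'M[R]_(dim V), forall i j, b j * sigma (end_to_mx v Q f i j) =
    b i * (end_to_mx v Q f (s i) (s j) + a * H (s i) (s j)).
Proof.
set A := end_to_mx v Q f.
have re (F : 'I_(dim V) -> V) : \sum_j F j = \sum_j F (s j).
  exact: (reindex_inj (@perm_inj _ s)).
have unre (c : 'I_(dim V) -> R) : \sum_j c j *: v (s j) = \sum_j c (s^-1 j)%g *: v j.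
  by rewrite [RHS]re; apply: eq_bigr => j _; rewrite permK.
have endE (h : {linear V -> V}) i : h (v i) = \sum_j end_to_mx v Q h i j *: v j.
  by rewrite -{1}(end_to_mxK QP h) mx_end_basis.
have lhs i : phi (f (v i)) = \sum_j (b j * sigma (A i j)) *: v (s j).
  rewrite endE linear_sum; apply: eq_bigr => j _.
  by rewrite linearZ /= phi_v scalerA mulrC.
have rhs (h : {linear V -> V}) i : f (phi (v i)) + a *: h (phi (v i)) =
    \sum_j (b i * (A (s i) (s j) + a * end_to_mx v Q h (s i) (s j))) *: v (s j).
  have ends (g : {linear V -> V}) :
      g (v (s i)) = \sum_j end_to_mx v Q g (s i) (s j) *: v (s j) by rewrite endE re.
  rewrite phi_v !linearZ /= !ends !scaler_sumr -big_split; apply: eq_bigr => j _ /=.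
  by rewrite !scalerA -scalerDl -mulrA mulrDr.
split=> [[h hE]|[H HE]].
  exists (end_to_mx v Q h) => i j; have := hE (v i); rewrite lhs rhs !unre.
  by move/(coords_inj PQ)/(_ (s j)); rewrite permK.
exists (mx_end v Q H) => x; have [c ->] := span x.
rewrite !linear_sum -big_split; apply: eq_bigr => i _.
rewrite !linearZ /= -scalerDr; congr (_ *: _).
by rewrite lhs rhs mx_endK //; apply: eq_bigr => j _; rewrite HE.
Qed.

End SemilinearMonomial.

(** * Equations of the automorphism schemes *)

Section MonomialSystem.
Context (k : fieldType) (p : nat).
Context (r : nat) (pi : 'S_r) (e : 'I_r -> nat).
Hypothesis e_le1 : forall i, (e i <= 1)%N.
Hypothesis pi_cycle : forall i j, j \in porbit pi i.
Context (m : nat).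
Local Notation T := ('I_r * 'I_r)%type.
Local Notation tau := (pair_map pi).
Local Notation ht := (height pi e).
Local Notation eps := (slope_diff e).
Implicit Types (z : T) (x : T -> nat -> k) (t : T -> k).

(** The exponent [1 + eps z] collects the Frobenius of [phi] and those in the factors [p = V F]. The
    last two conditions are the links whose other end would have level -1. *)
Definition monomial_system x :=
  [/\ forall z l l', (l < m)%N -> (l' < m)%N -> l'%:Z = l%:Z + eps z ->
        x (tau z) l' = x z l ^+ (p ^ (absz (1 + eps z)%R)),
      forall z, eps z = -1 -> x z 0%N = 0
    & forall z, eps z = 1 -> x (tau z) 0%N = 0].

(** Ensures that [absz] leaves the exponents [u%:Z + ht z u] unchanged. *)
Lemma ht_ge z u : - u%:Z <= ht z u.
Proof.
by elim: u => [|u IHu]; rewrite ?ht0 // htS; have := eps_bound e_le1 (iter u tau z); lia.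
Qed.

Lemma monomial_path x z l b : monomial_system x ->
  (forall w, (w <= b)%N -> 0 <= l%:Z + ht z w < m%:Z) ->
  x (iter b tau z) (absz (l%:Z + ht z b)%R) = x z l ^+ (p ^ (absz (b%:Z + ht z b)%R)).
Proof.
move=> [R1 _ _]; elim: b => [|b IHb] lev.
  by rewrite ht0 !addr0 /= expn0 expr1.
have lev_b := lev b (leqnSn b); have lev_Sb := lev b.+1 (leqnn _).
have h_b := ht_ge z b; have e_b := eps_bound e_le1 (iter b tau z).
have hS := htS pi e z b.
rewrite iterS (R1 _ (absz (l%:Z + ht z b)%R)); last 3 first.
- by lia.
- by lia.
- by lia.
rewrite IHb => [|w wb]; last by apply: lev; apply: leqW.
rewrite -exprM -expnD; congr (_ ^+ (p ^ _)); lia.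
Qed.

(** The ends of an excursion are placed at level [m], just outside the range, so that its interior
    consists of coordinates. *)
Definition covers (z0 : T) (u : nat) (z : T) (l : nat) := exists2 s,
  excursion pi e m z0 s &
  [/\ (0 < u < s)%N, z = iter u tau z0 & l%:Z = m%:Z + ht z0 u].

Lemma covers_uniq z0 u z0' u' z l :
  covers z0 u z l -> covers z0' u' z l -> (z0, u) = (z0', u').
Proof.
wlog le : z0 z0' u u' / (u <= u')%N => [IH c c'|].
  by have [le|/ltnW le] := leqP u u'; [|apply/esym]; apply: IH le _ _.
move=> [s [_ _ _] [us zE lE]] [s' [_ _ bs'] [us' zE' lE']].
have z0E : z0 = iter (u' - u) tau z0'.
  by apply: (@iter_tau_inj _ pi u); rewrite -iterD subnKC // -zE.
have [eq|ne] := eqVneq u u'; first by rewrite z0E eq subnn.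
have := htD pi e z0' (u' - u) u; rewrite subnK // -z0E => h.
by have := bs' (u' - u)%N; lia.
Qed.

Lemma covers_free z0 u z l : covers z0 u z l -> z0 \in free_pairs pi e m.
Proof. by move=> [s exc _]; apply/free_pairsP; exists s. Qed.

Hypothesis m_gt0 : (0 < m)%N.

Lemma covers_start z0 : z0 \in free_pairs pi e m -> covers z0 1 (tau z0) m.-1.
Proof.
move=> /free_pairsP[s [s1 hs bs]]; have := bs 1%N; rewrite s1 ht1 => /(_ isT) b1.
by have := eps_bound e_le1 z0; exists s => //; split=> //; rewrite ht1; lia.
Qed.

Lemma covers_next z0 u z l l' : covers z0 u z l -> (l' < m)%N ->
  l'%:Z = l%:Z + eps z -> covers z0 u.+1 (tau z) l'.
Proof.
move=> [s [s1 hs bs] [/andP[u0 us] zE lE]] l'm l'E; have hS := htS pi e z0 u.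
rewrite -zE in hS; exists s; split=> //; [|by rewrite iterS zE|lia].
have : u.+1 != s by apply/eqP => E; rewrite E in hS; lia.
by lia.
Qed.

Lemma covers_prev z0 u z l : covers z0 u (tau z) l ->
  (z0 = z /\ u = 1%N /\ eps z = -1 /\ l = m.-1) \/
  exists l', [/\ l%:Z = l'%:Z + eps z, (0 < u.-1)%N & covers z0 u.-1 z l'].
Proof.
move=> [s [s1 hs bs] [/andP[u0 us] zE lE]].
case: u u0 us zE lE => // u _ us zE lE; have hS := htS pi e z0 u.
have {}zE : z = iter u tau z0 by apply: (@tau_inj _ pi); exact: zE.
rewrite -zE in hS; case: u => [|u] in us zE lE hS *.
  left; rewrite /= in zE; subst z; have := bs 1%N; rewrite s1 => /(_ isT).
  have := eps_bound e_le1 z0; rewrite ht1 in lE *; split=> //; split=> //.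
  by split; lia.
right; have bu := bs u.+1; have {}bu : - m%:Z <= ht z0 u.+1 < 0 by apply: bu; lia.
exists (absz (m%:Z + ht z0 u.+1)%R); split=> //; first by lia.
by exists s => //=; split=> //; lia.
Qed.

Hypothesis p_gt0 : (0 < p)%N.

(* A node outside every excursion either lies on a cycle of the system, or its
   path leaves through level [-1] in one of the two directions. *)
Lemma uncovered_periodic x z l : monomial_system x -> (l < m)%N ->
  (forall z0 u, ~ covers z0 u z l) -> x z l ^+ (p ^ r) = x z l.
Proof.
move=> sys lm unc; have [R1 R2 R3] := sys.
have x0 : x z l = 0 -> x z l ^+ (p ^ r) = x z l.
  by move=> ->; rewrite expr0n expn_eq0 eqn0Ngt p_gt0.
have pow0 (a : k) c : a ^+ (p ^ c) = 0 -> a = 0.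
  by move/eqP; rewrite expf_eq0 => /andP[_ /eqP].
pose L w := l%:Z + ht z w.
pose out w := ~~ ((0 <= L w) && (L w < m%:Z)).
have L0 : L 0%N = l by rewrite /L ht0 addr0.
have LS w : L w.+1 = L w + eps (iter w tau z) by rewrite /L htS addrA.
have Lr w : L (r + w)%N = L w by rewrite /L htDr.
have [/existsP[w0 w0out]|/existsPn allin] := boolP [exists w : 'I_r, out w]; last first.
  have inr w : (w <= r)%N -> 0 <= l%:Z + ht z w < m%:Z.
    rewrite leq_eqVlt => /orP[/eqP->|wr].
      by rewrite ht_r // addr0; lia.
    by have := allin (Ordinal wr); rewrite negbK.
  have := monomial_path sys inr; rewrite iter_tau_r // ht_r // !addr0 /=.
  by move=> <-.
have exout : exists w, out w && (w < r)%N by exists w0; rewrite w0out ltn_ord.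
have [u1 /andP[out1 u1r] min1] := ex_minnP exout.
have ub w : out w && (w < r)%N -> (w <= r)%N by move=> /andP[_ /ltnW].
have [u2 /andP[out2 u2r] max2] := ex_maxnP exout ub.
have in1 w : (w < u1)%N -> 0 <= L w < m%:Z.
  move=> wu; rewrite -[_ && _]negbK; apply/negP => ow.
  have := min1 w; rewrite /out ow (ltn_trans wu u1r) => /(_ isT).
  by rewrite leqNgt wu.
have in2 w : (u2 < w <= r)%N -> 0 <= L w < m%:Z.
  move=> /andP[u2w]; rewrite leq_eqVlt => /orP[/eqP->|wr].
    by rewrite -(addn0 r) Lr L0; lia.
  rewrite -[_ && _]negbK; apply/negP => ow.
  by have := max2 w; rewrite /out ow wr => /(_ isT); rewrite leqNgt u2w.
have u1_gt0 : (0 < u1)%N by case: (u1) out1 => //; rewrite /out L0; lia.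
(* The first exit forwards is through level [m], or through level -1, where the system forces 0. *)
have top1 : L u1 = m \/ x z l = 0.
  have in1p := in1 u1.-1; have L1 := LS u1.-1; rewrite prednK // in L1 in1p.
  have {}in1p := in1p (leqnn _); have e1 := eps_bound e_le1 (iter u1.-1 tau z).
  have [->|nm] := eqVneq (L u1) m%:Z; [by left|right].
  have Lm1 : L u1 = -1 by move: out1; rewrite /out; lia.
  have path : x (iter u1.-1 tau z) (absz (l%:Z + ht z u1.-1)%R) =
      x z l ^+ (p ^ (absz (u1.-1%:Z + ht z u1.-1)%R)).
    by apply: monomial_path => // w wu; apply: in1; lia.
  apply: (pow0 _ (absz (u1.-1%:Z + ht z u1.-1)%R)); rewrite -path.
  rewrite (_ : absz _ = 0%N); last by rewrite -/(L u1.-1); lia.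
  by apply: R2; lia.
(* Likewise backwards: [u2] is the last time outside the range before the period closes. *)
have top2 : L u2 = m \/ x z l = 0.
  have in2p := in2 u2.+1; rewrite leqnn u2r in in2p; have {}in2p := in2p isT.
  have e2 := eps_bound e_le1 (iter u2 tau z); have L2 := LS u2.
  have [->|nm] := eqVneq (L u2) m%:Z; [by left|right].
  have Lm1 : L u2 = -1 by move: out2; rewrite /out; lia.
  have hD w : ht z (u2.+1 + w) = ht z u2.+1 + ht (iter u2.+1 tau z) w by rewrite htD.
  have h0 : ht z u2.+1 = - l%:Z by move: L2 Lm1 in2p; rewrite /L; lia.
  have lev w : (w <= r - u2.+1)%N -> 0 <= 0%:Z + ht (iter u2.+1 tau z) w < m%:Z.
    by move=> wr; have := in2 (u2.+1 + w)%N; rewrite /L hD h0; lia.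
  have := monomial_path sys lev; rewrite -iterD subnK // iter_tau_r //.
  have -> : (absz (0%:Z + ht (iter u2.+1 tau z) (r - u2.+1))%R) = l.
    by have := hD (r - u2.+1)%N; rewrite subnKC // ht_r // h0; lia.
  move=> ->; rewrite iterS R3; last by lia.
  by rewrite expr0n expn_eq0 eqn0Ngt p_gt0.
case: top1 => [top1|/x0//]; case: top2 => [top2|/x0//].
(* With both exits at level [m], the stretch from [u2] to [r + u1] is an excursion covering the
   given coordinate. *)
case: (unc (iter u2 tau z) (r - u2)%N).
have hD w : ht z (u2 + w) = ht z u2 + ht (iter u2 tau z) w by rewrite htD.
have LD w : ht (iter u2 tau z) w = L (u2 + w)%N - m%:Z by rewrite -top2 /L hD; ring.
exists (r - u2 + u1)%N; split.
- by lia.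
- by rewrite LD addnA subnKC ?(ltnW u2r) // Lr top1 subrr.
- move=> w /andP[w_gt0 ws]; rewrite LD; have [wr|rw] := leqP (u2 + w)%N r.
    by have := in2 (u2 + w)%N; lia.
  have := in1 (u2 + w - r)%N; have := Lr (u2 + w - r)%N.
  by rewrite subnKC ?(ltnW rw) // => ->; lia.
- by lia.
- by rewrite -iterD subnK ?iter_tau_r // ltnW.
by rewrite LD subnKC ?(ltnW u2r) // -(addn0 r) Lr L0; ring.
Qed.

Definition cover_of z l : option (T * nat) :=
  if pselect (exists zu : T * nat, covers zu.1 zu.2 z l) is left ex
  then Some (projT1 (cid ex)) else None.

Variant cover_spec z l : option (T * nat) -> Type :=
  | Covered z0 u of covers z0 u z l : cover_spec z l (Some (z0, u))
  | Uncovered of (forall z0 u, ~ covers z0 u z l) : cover_spec z l None.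

Lemma cover_ofP z l : cover_spec z l (cover_of z l).
Proof.
rewrite /cover_of; case: pselect => [ex|nex].
  by case: (cid ex) => -[z0 u] /= c; constructor.
by constructor => z0 u c; apply: nex; exists (z0, u).
Qed.

Lemma cover_of_some z0 u z l : covers z0 u z l -> cover_of z l = Some (z0, u).
Proof.
move=> c; case: cover_ofP => [z0' u' c'|/(_ z0 u)//].
by rewrite (covers_uniq c' c).
Qed.

Lemma cover_of_none z l : (forall z0 u, ~ covers z0 u z l) -> cover_of z l = None.
Proof. by move=> unc; case: cover_ofP => // z0 u /unc. Qed.

(** The parameter of an excursion is its first coordinate, of level [m.-1], where the exponent is
    [1 - 1 = 0]. *)
Definition solution (c : T -> nat -> k) t z l : k :=
  if cover_of z l is Some (z0, u) then t z0 ^+ (p ^ (absz (u%:Z + ht z0 u)%R)) else c z l.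

Lemma solution_complete x : monomial_system x ->
  exists c t, (forall z l, (l < m)%N -> c z l ^+ (p ^ r) = c z l) /\
    forall z l, (l < m)%N -> x z l = solution c t z l.
Proof.
move=> sys; pose c z l := if cover_of z l is Some _ then 0 else x z l.
exists c, (fun z0 => x (tau z0) m.-1); split=> z l lm; rewrite /c /solution.
  case: cover_ofP => [z0 u _|unc]; last exact: uncovered_periodic.
  by rewrite expr0n expn_eq0 eqn0Ngt p_gt0.
case: cover_ofP => // z0 u [s exc [/andP[u0 us] zE lE]].
have [s1 hs bs] := exc; have b1 := bs 1%N; rewrite s1 ht1 in b1.
have {}b1 := b1 isT; have e1 := eps_bound e_le1 z0.
case: u u0 us zE lE => // u _ us zE lE.
have hD w : ht z0 w.+1 = eps z0 + ht (tau z0) w by rewrite htSl.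
have lev w : (w <= u)%N -> 0 <= m.-1%:Z + ht (tau z0) w < m%:Z.
  by move=> wu; have := bs w.+1; have := hD w; lia.
have := monomial_path sys lev; rewrite -iterSr -zE.
have hu := hD u.
rewrite (_ : (absz (m.-1%:Z + _)%R) = l) => [->|]; last by lia.
by congr (_ ^+ (p ^ _)); have := ht_ge z0 u.+1; lia.
Qed.

(** The Witt coordinates of the identity matrix. *)
Definition diag_sol z l : k := ((z.1 == z.2) && (l == 0%N))%:R.

Lemma eps_diag z : z.1 = z.2 -> eps z = 0.
Proof. by rewrite /slope_diff => ->; rewrite subrr. Qed.

Lemma solution_system t : monomial_system (solution diag_sol t).
Proof.
have p0 : (p == 0)%N = false by apply/negbTE; rewrite -lt0n.
split=> [z l l' lm l'm l'E|z ez|z ez]; rewrite /solution.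
- case: (cover_ofP z l) => [z0 u c|unc].
    rewrite (cover_of_some (covers_next c l'm l'E)).
    have [s _ [_ zE lE]] := c; have := htS pi e z0 u; rewrite -zE => hS.
    rewrite -exprM -expnD; congr (_ ^+ (p ^ _)).
    by have := ht_ge z0 u; have := eps_bound e_le1 z; lia.
  rewrite cover_of_none => [|z0 u c].
    rewrite /diag_sol /= (inj_eq perm_inj).
    have [/eps_diag ez|_] := eqVneq z.1 z.2.
      rewrite ez in l'E *; have -> : l' = l by lia.
      by case: (l == 0%N) => /=; rewrite ?expr1n // expr0n expn_eq0 p0.
    by rewrite expr0n expn_eq0 p0.
  have [[_ [_ [ez lE]]]|[l0 [l0E _ c0]]] := covers_prev c; first by lia.
  have l0l : l0 = l by lia.
  by rewrite l0l in c0; case: (unc _ _ c0).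
- rewrite cover_of_none => [|z0 u [s [s1 hs bs] [us zE lE]]].
    rewrite /diag_sol; case: eqP => // /eps_diag; lia.
  have hS := htS pi e z0 u; rewrite -zE in hS.
  have [E|ne] := eqVneq u.+1 s; first by rewrite E in hS; lia.
  by have := bs u.+1; lia.
rewrite cover_of_none => [|z0 u c].
  rewrite /diag_sol /= (inj_eq perm_inj); case: eqP => // /eps_diag; lia.
have [[_ [_ [ez' _]]]|[l0 [l0E _ c0]]] := covers_prev c; first by lia.
by lia.
Qed.

(** An excursion never meets the diagonal, where all heights are 0. *)
Lemma solution0 z : solution diag_sol (fun=> 0) z 0 = (z.1 == z.2)%:R.
Proof.
rewrite /solution; case: cover_ofP => [z0 u|_]; last by rewrite /diag_sol andbT.
move=> [s [s1 hs bs] [us zE lE]].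
rewrite expr0n expn_eq0 eqn0Ngt p_gt0 /=; case: eqP => // zd.
have zd0 : z0.1 = z0.2.
  move: zd; rewrite zE (surjective_pairing z0) iter_tau /=.
  by elim: (u) => // w IHw /perm_inj.
by have := bs 1%N; rewrite s1 ht1 eps_diag // => /(_ isT); lia.
Qed.

End MonomialSystem.

(** * Stability modulo [p ^ m] in Witt coordinates *)

Section StableMatrices.
Context (k : closedFieldType) (p : nat) (pchark : p \in [pchar k]).
Local Notation W := (witt pchark).
Local Notation sigma := (@wfrob k p pchark).
Context (r : nat) (pi : 'S_r) (e : 'I_r -> nat).
Hypothesis e_le1 : forall i, (e i <= 1)%N.
Context (m : nat) (m_gt0 : (0 < m)%N).
Local Notation T := ('I_r * 'I_r)%type.
Local Notation tau := (pair_map pi).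
Local Notation eps := (slope_diff e).

Definition stable_entries (X : T -> W) := exists H : T -> W, forall z,
  p%:R ^+ e z.2 * sigma (X z) = p%:R ^+ e z.1 * (X (tau z) + p%:R ^+ m * H (tau z)).

Lemma wsigma_mulpX_coef n (x : W) l :
  (p%:R ^+ n * sigma x) l = if (l < n)%N then 0 else x (l - n)%N ^+ (p ^ n.+1).
Proof. by rewrite wmulpX_coef; case: ltnP => //= _; rewrite -exprM -expnS. Qed.

Lemma wmulpX_coefD n (x : W) l : (p%:R ^+ n * x) (l + n)%N = x l ^+ (p ^ n).
Proof. by rewrite wmulpX_coef ltnNge leq_addl addnK. Qed.

Lemma wsigma_coefD n (x : W) l :
  (p%:R ^+ n * sigma x) (l + n)%N = x l ^+ (p ^ n.+1).
Proof. by rewrite wmulpX_coefD -exprM -expnS. Qed.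

(** Coordinate [l + e z.2] is compared on both sides; the common [p]-power is then removed by
    injectivity of Frobenius. *)
Lemma stable_system X : stable_entries X ->
  monomial_system p pi e m (fun z l => X z l).
Proof.
move=> [H XH].
have coefE z l : (p%:R ^+ e z.2 * sigma (X z)) l =
    (p%:R ^+ e z.1 * (X (tau z) + p%:R ^+ m * H (tau z))) l by rewrite XH.
have low z l : (l < m)%N -> (X (tau z) + p%:R ^+ m * H (tau z)) l = X (tau z) l.
  have : wcong m (X (tau z) + p%:R ^+ m * H (tau z)) (X (tau z)).
    by apply/wcongP; exists (H (tau z)).
  exact.
have e1 (z : T) := e_le1 z.1; have e2 (z : T) := e_le1 z.2.
split=> [z l l' lm l'm|z|z]; rewrite /slope_diff => ez.
- have := coefE z (l + e z.2)%N; rewrite wsigma_coefD.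
  rewrite (_ : (l + e z.2)%N = (l' + e z.1)%N); last by lia.
  rewrite wmulpX_coefD low // => E; apply: (@ppower_inj _ _ pchark (e z.1)).
  rewrite /= -E -exprM -expnD; congr (_ ^+ (p ^ _)).
  by have := e1 z; have := e2 z; lia.
- have := coefE z 0%N; rewrite wsigma_mulpX_coef wmulpX_coef.
  rewrite (_ : (0 < e z.2)%N = false); last by have := e1 z; lia.
  rewrite (_ : (0 < e z.1)%N = true); last by have := e1 z; lia.
  by rewrite sub0n => /eqP; rewrite expf_eq0 => /andP[_ /eqP].
have := coefE z 0%N; rewrite wsigma_mulpX_coef wmulpX_coef.
rewrite (_ : (0 < e z.2)%N = true); last by have := e1 z; lia.
rewrite (_ : e z.1 = 0%N); last by have := e2 z; lia.
by rewrite ltn0 subn0 low // expn0 expr1.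
Qed.

Lemma system_stable (x : T -> nat -> k) : monomial_system p pi e m x ->
  exists2 X : T -> W, (forall z l, (l < m)%N -> X z l = x z l) & stable_entries X.
Proof.
move=> [R1 R2 R3].
(* If [eps z = -1], division by [p] brings coordinate [m] of [X z] into play; it is set to match
   level [m.-1] at [tau z]. *)
pose X z : W := Witt pchark (fun l => if (l < m)%N then x z l else
  if (l == m) && (eps z == -1) then x (tau z) m.-1 else 0).
have XE z l : (l < m)%N -> X z l = x z l by move=> lm; rewrite /= lm.
have ex z : exists h : W,
    p%:R ^+ e z.2 * sigma (X z) = p%:R ^+ e z.1 * (X (tau z) + p%:R ^+ m * h).
  have e1 := e_le1 z.1; have e2 := e_le1 z.2.
  have [le|lt] := leqP (e z.1) (e z.2).
    have /wcongP[h hE] : wcong m (p%:R ^+ (e z.2 - e z.1) * sigma (X z)) (X (tau z)).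
      move=> l lm; rewrite wsigma_mulpX_coef; case: ltnP => le'.
        by rewrite XE // (_ : l = 0%N) ?R3 // /slope_diff; lia.
      rewrite !XE //; last by lia.
      rewrite (R1 z (l - (e z.2 - e z.1))%N l) //; last 2 first.
      - by lia.
      - by rewrite /slope_diff; lia.
      by congr (_ ^+ (p ^ _)); rewrite /slope_diff; lia.
    by exists h; rewrite -hE mulrA -exprD subnKC.
  have [e1E e2E] : e z.1 = 1%N /\ e z.2 = 0%N by lia.
  have ez : eps z = -1 by rewrite /slope_diff e1E e2E.
  pose y := Witt pchark (fun l => X z l.+1).
  have /wcongP[h hE] : wcong m y (X (tau z)).
    move=> l lm; rewrite [RHS]XE // /y /=; case: ltnP => [lm1|le'].
      by rewrite (R1 z l.+1 l) // ez ?expr1 //; lia.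
    by rewrite (_ : l = m.-1) ?prednK ?eqxx ?ez //; lia.
  exists h; rewrite -hE e1E e2E expr0 mul1r expr1 wmulpE.
  apply/witt_coefP => -[|l] //=; rewrite m_gt0 R2 //.
  by rewrite expr0n; case: (p) (pcharf_prime pchark).
have [h hE] := choice ex; exists X => //.
exists (fun z => h (invF (@tau_inj _ pi) z)) => z.
by rewrite hE invF_f.
Qed.

End StableMatrices.

Section StableEndomorphisms.
Context (k : closedFieldType) (p : nat) (pchark : p \in [pchar k]).
Local Notation W := (witt pchark).
Local Notation sigma := (@wfrob k p pchark).
Context (M : fcrystal pchark) (v : 'I_(dim M) -> M) (e : 'I_(dim M) -> nat).
Context (s : 'S_(dim M)).
Local Notation phi := (fc_phi M).
Hypothesis span : forall x, exists c : 'I_(dim M) -> W, x = \sum_i c i *: v i.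
Hypothesis phi_v : forall i, phi (v i) = p%:R ^+ e i *: v (s i).
Context (Q : 'M[W]_(dim M)).
Hypothesis QP : Q *m basis_mx v = 1%:M.
Hypothesis PQ : basis_mx v *m Q = 1%:M.

Lemma phi_stable_modP m (f : {linear M -> M}) :
  phi_stable_mod m f <->
  stable_entries s e m (fun z => end_to_mx v Q f z.1 z.2).
Proof.
have E := semilinear_commute_mod span phi_v QP PQ (p%:R ^+ m) f.
split=> [/E[H HE]|[H HE]].
  by exists (fun z => H z.1 z.2) => z; apply: HE.
apply/E; exists (\matrix_(i, j) H (i, j)) => i j.
rewrite [X in _ = _ * (_ + _ * X)]mxE; exact: (HE (i, j)).
Qed.

End StableEndomorphisms.

(** * Polynomial maps into Witt vectors, and points modulo [p ^ m] *)

Section PolynomialMaps.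
Context (k : closedFieldType) (p : nat) (pchark : p \in [pchar k]) (n : nat).
Local Notation W := (witt pchark).
Implicit Types g : ('I_n -> k) -> W.

Definition wpoly g := exists F : nat -> {mpoly k[n]}, forall x l, g x l = (F l).@[x].

Lemma wpoly_const (a : W) : wpoly (fun=> a).
Proof. by exists (fun l => (a l)%:MP) => x l; rewrite mevalC. Qed.

(** [F1] and [F2] are Witt vectors over the polynomial ring, and evaluation commutes with Witt
    addition. *)
Lemma wpolyD g1 g2 : wpoly g1 -> wpoly g2 -> wpoly (fun x => g1 x + g2 x).
Proof.
move=> [F1 E1] [F2 E2]; exists (wadd p F1 F2) => x l.
have h := congr1 (fun f => f l) (wadd_morph p (meval x) F1 F2).
apply: etrans (esym h); rewrite -[LHS]/(wadd p (g1 x) (g2 x) l).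
by congr (wadd p _ _ l); apply/funext => i; rewrite /= ?E1 ?E2.
Qed.

Lemma wpolyM g1 g2 : wpoly g1 -> wpoly g2 -> wpoly (fun x => g1 x * g2 x).
Proof.
move=> [F1 E1] [F2 E2]; exists (wmul p F1 F2) => x l.
have h := congr1 (fun f => f l) (wmul_morph p (meval x) F1 F2).
apply: etrans (esym h); rewrite -[LHS]/(wmul p (g1 x) (g2 x) l).
by congr (wmul p _ _ l); apply/funext => i; rewrite /= ?E1 ?E2.
Qed.

Lemma wpoly_sum (I : Type) (s : seq I) (g : I -> ('I_n -> k) -> W) :
  (forall i, wpoly (g i)) -> wpoly (fun x => \sum_(i <- s) g i x).
Proof.
move=> gP; elim: s => [|i s IHs].
  by have [F E] := wpoly_const 0; exists F => x l; rewrite big_nil -E.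
have [F E] := wpolyD (gP i) IHs; exists F => x l; rewrite big_cons; exact: E.
Qed.

Definition mxpoly r (A : ('I_n -> k) -> 'M[W]_r) := forall i j, wpoly (fun x => A x i j).

Lemma mxpolyM r (A B : ('I_n -> k) -> 'M[W]_r) :
  mxpoly A -> mxpoly B -> mxpoly (fun x => A x *m B x).
Proof.
move=> AP BP i j; have [F E] : wpoly (fun x => \sum_l A x i l * B x l j).
  by apply: wpoly_sum => l; apply: wpolyM.
by exists F => x l; rewrite mxE; apply: E.
Qed.

Lemma mxpoly_const r (A : 'M[W]_r) : mxpoly (fun=> A).
Proof. by move=> i j; apply: wpoly_const. Qed.

End PolynomialMaps.

Section Points.
Context (k : closedFieldType) (p : nat) (pchark : p \in [pchar k]) (r m : nat).
Local Notation W := (witt pchark).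
Local Notation T := ('I_r * 'I_r)%type.
Local Notation N := #|{: 'I_r * 'I_r * 'I_m}|.

Definition mx_point (A : 'M[W]_r) : 'I_N -> k :=
  fun t => let: (i, j, l) := enum_val t in wcoef (A i j) l.

Definition mxcong (A B : 'M[W]_r) := forall i j, wcong m (A i j) (B i j).

Lemma mxcongM A A' B B' : mxcong A A' -> mxcong B B' -> mxcong (A *m B) (A' *m B').
Proof.
by move=> AA BB i j; rewrite !mxE; apply: wcong_sum => l; apply: wcongM.
Qed.

Lemma mxcong_refl A : mxcong A A. Proof. by []. Qed.

Lemma mx_pointP A B : mx_point A = mx_point B <-> mxcong A B.
Proof.
split=> [E i j l lm|AB].
  have := congr1 (fun f => f (enum_rank (i, j, Ordinal lm))) E.
  by rewrite /mx_point enum_rankK.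
apply/funext => t; rewrite /mx_point; case: (enum_val t) => -[i j] l.
exact/AB/ltn_ord.
Qed.

Lemma mxcong_red A B : (0 < m)%N -> mxcong A B ->
  map_mx (@wred k p pchark) A = map_mx (@wred k p pchark) B.
Proof. by move=> m0 AB; apply/matrixP => i j; rewrite !mxE; apply: AB. Qed.

Definition point_mx (y : 'I_N -> k) : 'M[W]_r := \matrix_(i, j)
  Witt pchark (fun l =>
    if insub l is Some l' then y (enum_rank (i, j, l' : 'I_m)) else 0).

Lemma mx_pointK A : mxcong (point_mx (mx_point A)) A.
Proof.
by move=> i j l lm; rewrite mxE /= insubT /mx_point enum_rankK.
Qed.

Lemma mxpoly_point : mxpoly point_mx.
Proof.
move=> i j; exists (fun l =>
  if insub l is Some l' then 'X_(enum_rank (i, j, l' : 'I_m)) else 0).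
by move=> y l; rewrite mxE /=; case: insub => [l'|]; rewrite ?mevalXU ?meval0.
Qed.

Lemma mxpoly_mx_point n (A : ('I_n -> k) -> 'M[W]_r) : mxpoly A ->
  exists th : N.-tuple {mpoly k[n]}, forall x,
    mx_point (A x) = fun t => (tnth th t).@[x].
Proof.
move=> AP; have [F E] := choice (fun ij : T => AP ij.1 ij.2).
exists [tuple let: (i, j, l) := enum_val t in F (i, j) (l : 'I_m) | t < N] => x.
apply/funext => t; rewrite tnth_mktuple /mx_point.
by case: (enum_val t) => -[i j] l; apply: (E (i, j)).
Qed.

End Points.

(** * Dimension of the stabiliser modulo [p ^ m] *)

Section Gamma.
Context (k : closedFieldType) (p : nat) (pchark : p \in [pchar k]).
Local Notation W := (witt pchark).
Local Notation red := (map_mx (@wred k p pchark)).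
Context (r : nat) (s : 'S_r) (e : 'I_r -> nat) (m : nat) (m_gt0 : (0 < m)%N).
Hypothesis e_le1 : forall i, (e i <= 1)%N.
Hypothesis s_cycle : forall i j, j \in porbit s i.
Local Notation T := ('I_r * 'I_r)%type.
Local Notation S := (free_pairs s e m).
Local Notation d := #|S|.
Local Notation N := #|{: 'I_r * 'I_r * 'I_m}|.
Let p_gt0 : (0 < p)%N := prime_gt0 (pcharf_prime pchark).

Definition start_value (t : 'I_d -> k) (z : T) : k :=
  if [pick i : 'I_d | enum_val i == z] is Some i then t i else 0.

Lemma start_value_enum t i : start_value t (enum_val i) = t i.
Proof.
rewrite /start_value; case: pickP => [j /eqP/enum_val_inj-> //|/(_ i)].
by rewrite eqxx.
Qed.

Lemma start_value_in (t0 : T -> k) z : z \in S ->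
  start_value (fun i => t0 (enum_val i)) z = t0 z.
Proof.
move=> zS; rewrite /start_value; case: pickP => [j /eqP->//|].
by move/(_ (enum_rank_in zS z)); rewrite enum_rankK_in // eqxx.
Qed.

Definition sol (c : T -> nat -> k) (t : 'I_d -> k) z l : k :=
  solution p s e m c (start_value t) z l.

Definition sol_poly (c : T -> nat -> k) z l : {mpoly k[d]} :=
  if cover_of s e m z l is Some (z0, u) then
    (if [pick i : 'I_d | enum_val i == z0] is Some i then 'X_i else 0)
      ^+ (p ^ (absz (u%:Z + height s e z0 u)%R))
  else (c z l)%:MP.

Lemma sol_polyE c t z l : (sol_poly c z l).@[t] = sol c t z l.
Proof.
rewrite /sol_poly /sol /solution; case: cover_of => [[z0 u]|]; last exact: mevalC.
rewrite rmorphXn /=; congr (_ ^+ _); rewrite /start_value.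
by case: pickP => [i _|_]; rewrite ?mevalXU ?meval0.
Qed.

Definition sol_mx c t : 'M[W]_r := \matrix_(i, j) Witt pchark (sol c t (i, j)).

Lemma mxpoly_sol c : mxpoly (sol_mx c).
Proof. by move=> i j; exists (sol_poly c (i, j)) => t l; rewrite mxE sol_polyE. Qed.

Context (P Q : 'M[W]_r) (QP : Q *m P = 1%:M) (PQ : P *m Q = 1%:M).

(** Conjugation by [P] passes from the adapted basis to the standard one, in which points are
    recorded. *)
Definition stable_points : set ('I_N -> k) :=
  [set x | exists A : 'M[W]_r, [/\ exists B, A *m B = 1%:M,
     stable_entries s e m (fun z => A z.1 z.2) & x = mx_point (Q *m A *m P)]].

Lemma conj_mxcong A B : mxcong m (Q *m A *m P) (Q *m B *m P) <-> mxcong m A B.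
Proof.
split=> AB; last first.
  exact: (mxcongM (mxcongM (@mxcong_refl _ _ pchark r m Q) AB)
    (@mxcong_refl _ _ pchark r m P)).
have : mxcong m (P *m (Q *m A *m P) *m Q) (P *m (Q *m B *m P) *m Q).
  exact: mxcongM (mxcongM (@mxcong_refl _ _ pchark r m P) AB)
    (@mxcong_refl _ _ pchark r m Q).
by rewrite !mulmxA PQ !mul1mx -!mulmxA PQ !mulmx1.
Qed.

Lemma mxpoly_conj n (A : ('I_n -> k) -> 'M[W]_r) (B C : 'M[W]_r) :
  mxpoly A -> mxpoly (fun x => B *m A x *m C).
Proof.
move=> AP; apply: (mxpolyM (A := fun x => B *m A x)); last exact: mxpoly_const.
by apply: (mxpolyM (A := fun=> B)) AP; apply: mxpoly_const.
Qed.

Lemma ppower_fixed_finite : (0 < r)%N ->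
  exists rts : seq k, forall a, a ^+ (p ^ r) = a -> a \in rts.
Proof.
move=> r_gt0; have p1 := prime_gt1 (pcharf_prime pchark).
pose f : {poly k} := 'X^(p ^ r) - 'X.
have f0 : f != 0.
  have pr : (1 < p ^ r)%N by rewrite -(expn0 p) ltn_exp2l.
  rewrite -size_poly_eq0 /f size_polyDl size_polyXn //.
  by rewrite size_polyN size_polyX.
have [rts E] := closed_field_poly_normal f; exists rts => a aE.
have : root f a by rewrite rootE !hornerE aE subrr.
by rewrite E rootZ ?lead_coef_eq0 // root_prod_XsubC.
Qed.

(** Uncovered coordinates are roots of [X ^ (p ^ r) - X], so the points lie in finitely many
    polynomial images of [d]-space, one for each choice [g] of roots. *)
Lemma stable_points_no_chain : (0 < r)%N -> ~ has_chain stable_points d.+1.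
Proof.
move=> r_gt0; have [rts rtsP] := ppower_fixed_finite r_gt0.
pose G := {ffun T * 'I_m -> 'I_(size rts)}.
pose c (g : G) z l := if insub l is Some l' then rts`_(g (z, l' : 'I_m)) else 0.
have ex (g : G) := mxpoly_mx_point m (mxpoly_conj Q P (mxpoly_sol (c g))).
have [th thE] := choice ex.
apply: (@no_chain_param _ _ _ _ th) => x [A [_ stab ->]].
have sys := stable_system e_le1 m_gt0 stab.
have [c0 [t0 [c0P c0E]]] := solution_complete e_le1 s_cycle m_gt0 p_gt0 sys.
have c0r z (l : 'I_m) : (index (c0 z l) rts < size rts)%N.
  by rewrite index_mem rtsP ?c0P.
pose g : G := [ffun zl => Ordinal (c0r zl.1 zl.2)].
exists g, (fun i => t0 (enum_val i)); rewrite -thE; apply/mx_pointP/conj_mxcong.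
move=> i j l lm; rewrite (c0E (i, j) l lm) mxE /= /sol /solution.
case: (cover_ofP s e m (i, j) l) => [z0 u cov|_].
  by rewrite start_value_in // (covers_free cov).
by rewrite /c insubT /= ffunE /= nth_index // rtsP ?c0P.
Qed.

(** The chain lies in the family with the constants of the identity. The retraction returns to the
    adapted basis and reads the first coordinate of each excursion; [q] is the determinant modulo
    [p], equal to 1 at the origin. *)
Lemma stable_points_chain : has_chain stable_points d.
Proof.
have [th thE] := mxpoly_mx_point m (mxpoly_conj Q P (mxpoly_sol (@diag_sol k r))).
have rhoP := mxpoly_conj P Q (@mxpoly_point _ _ pchark r m).
have exrho (i : 'I_d) : exists F : {mpoly k[N]}, forall y,
    let z := pair_map s (enum_val i) in
    (P *m point_mx pchark y *m Q) z.1 z.2 m.-1 = F.@[y].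
  have [F E] := rhoP (pair_map s (enum_val i)).1 (pair_map s (enum_val i)).2.
  by exists (F m.-1).
have [rho rhoE] := choice exrho.
pose q := \det (\matrix_(i, j) sol_poly (@diag_sol k r) (i, j) 0).
have qE t : q.@[t] = \det (red (sol_mx (@diag_sol k r) t)).
  rewrite /q -det_map_mx; congr (\det _); apply/matrixP => i j.
  by rewrite !mxE /= sol_polyE.
apply: (@has_chain_param k _ _ stable_points th [tuple rho i | i < d] q).
- move=> t; apply/funext => i; rewrite tnth_mktuple -rhoE -thE.
  have := mxcongM (mxcongM (@mxcong_refl _ _ pchark r m P)
    (mx_pointK (Q *m sol_mx (@diag_sol k r) t *m P))) (@mxcong_refl _ _ pchark r m Q).
  rewrite (_ : P *m (_ *m _ *m P) *m Q = sol_mx (@diag_sol k r) t); last first.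
    by rewrite !mulmxA PQ mul1mx -mulmxA PQ mulmx1.
  move=> -> //; last by rewrite prednK.
  rewrite mxE /= -/(pair_map s (enum_val i)) /sol /solution.
  rewrite (cover_of_some (covers_start e_le1 m_gt0 (enum_valP i))).
  have [s' [s1 hs bs] _] := covers_start e_le1 m_gt0 (enum_valP i).
  have := bs 1%N; rewrite s1 ht1 => /(_ isT); have := eps_bound e_le1 (enum_val i).
  rewrite start_value_enum => h1 h2; rewrite (_ : absz _ = 0%N) ?expr1 //.
  by lia.
- move=> t; rewrite -thE qE; split=> [[A [Ainv stab E]]|qt].
    have AE : mxcong m (sol_mx (@diag_sol k r) t) A by apply/conj_mxcong/mx_pointP.
    by rewrite (mxcong_red m_gt0 AE); apply/mx_unit_red.
  have sys := solution_system s e_le1 m_gt0 p_gt0 (start_value t).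
  have [X XE stab] := system_stable pchark e_le1 m_gt0 sys.
  pose A : 'M[W]_r := \matrix_(i, j) X (i, j).
  have AE : mxcong m (sol_mx (@diag_sol k r) t) A.
    by move=> i j l lm; rewrite !mxE /= XE.
  exists A; split.
  - by apply/mx_unit_red; rewrite -(mxcong_red m_gt0 AE).
  - rewrite (_ : (fun z => _) = X) //; apply/funext => -[i j].
    by rewrite mxE.
  - exact/mx_pointP/conj_mxcong.
rewrite qE (_ : red _ = 1%:M) ?det1 ?oner_eq0 //; apply/matrixP => i j.
rewrite !mxE /wred /= /sol (_ : start_value _ = fun=> 0); last first.
  by apply/funext => z; rewrite /start_value; case: pickP.
by rewrite solution0.
Qed.

End Gamma.

Lemma gamma_free_pairs (k : closedFieldType) (p : nat) (pchark : p \in [pchar k])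
    (M : fcrystal pchark) (v : 'I_(dim M) -> M) (e : 'I_(dim M) -> nat)
    (s : 'S_(dim M)) m :
  (forall x, exists c : 'I_(dim M) -> witt pchark, x = \sum_i c i *: v i) ->
  (forall i, fc_phi M (v i) = p%:R ^+ e i *: v (s i)) ->
  (forall i, (e i <= 1)%N) -> (forall i j, j \in porbit s i) -> (0 < dim M)%N ->
  gamma M m = #|free_pairs s e m|.
Proof.
move=> span phi_v e_le1 s_cycle dimM; case: m => [|m].
  by rewrite free_pairs0 cards0.
have [Q [QP PQ]] := basis_mx_unit span.
have endE (f : {linear M -> M}) :
    @end_point _ _ _ M m.+1 f =
    @mx_point _ _ pchark _ m.+1 (Q *m end_to_mx v Q f *m basis_mx v).
  by rewrite -(std_mx_basis QP).
have -> : gamma M m.+1 =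
    zariski_dim (@stable_points _ _ pchark _ s e m.+1 (basis_mx v) Q).
  congr zariski_dim; apply/seteqP; split=> [x|x].
    move=> [f [fbij /(phi_stable_modP span phi_v QP PQ) stab] <-].
    exists (end_to_mx v Q f); split; [|exact: stab|exact: endE].
    exact: (end_to_mx_bij QP PQ fbij).
  move=> [A [[B AB] stab ->]]; pose f : {linear M -> M} := mx_end v Q A.
  have fA : end_to_mx v Q f = A by apply: (mx_endK QP PQ).
  exists f; last by rewrite endE fA.
  split; first exact: (mx_end_bij QP PQ AB).
  by apply/(phi_stable_modP span phi_v QP PQ); rewrite fA.
by apply: zariski_dim_eq; [apply: stable_points_chain|apply: stable_points_no_chain].
Qed.

Theorem theorem5p1 (k : closedFieldType) (p : nat) (pchark : p \in [pchar k])
    (M : fcrystal pchark) :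
  is_dieudonne M -> is_circular M -> ~ is_ordinary M -> (2 <= dim M)%N ->
  let n := isomorphism_number M in
  [/\ (1 <= n)%N,
      forall m, (1 <= m < n)%N ->
        (gamma M m)%:Z - (gamma M m.-1)%:Z >
        (gamma M m.+1)%:Z - (gamma M m)%:Z
    & (gamma M n)%:Z - (gamma M n.-1)%:Z > 0].
Proof.
move=> _ [v [e [s [basis e_le1 s_cycle phi_v]]]] nord dimM n.
have span x : exists c : 'I_(dim M) -> witt pchark, x = \sum_i c i *: v i.
  by have [c [xE _]] := basis x; exists c.
have /andP[n1 nmax] := isomorphism_number_bounds span phi_v e_le1 s_cycle nord.
have gammaE m := gamma_free_pairs m span phi_v e_le1 s_cycle (ltnW dimM).
split=> // [m /andP[m1 mn]|].
  (* Each difference of consecutive values of [gamma] is a number of deep pairs. *)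
  rewrite !gammaE (card_deep_pairs s e (m := m.+1)) // (card_deep_pairs s e m1) /=.
  have := @deep_pairs_decr _ s e e_le1 s_cycle m; rewrite m1 (leq_trans (ltnW mn) nmax).
  by move/(_ isT); set a := #|_|; set b := #|_|; lia.
rewrite !gammaE (card_deep_pairs s e n1).
have := @deep_pairs_gt0 _ s e e_le1 s_cycle n; rewrite n1 nmax => /(_ isT).
by set a := #|_|; set b := #|_|; lia.
Qed.
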